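(* Consider the stochastic gradient tracking iteration described in the context with stepsize $\alpha$, under the function assumption (each $f_i$ is $L$-smooth and $\mu$-strongly convex, $0\le\mu\le L$, $L>0$), the network assumption and the gradient-noise assumption of the context. If $0<\alpha\le\frac{1}{4L}$, then, for every $k\ge 0$, $$\widetilde X_{k+1}\le(1-\mu\alpha)\widetilde X_k+\frac{3\alpha L}{2}\widetilde E_k+\frac{\alpha^2\sigma^2}{N},$$ $$E_{k+1}\le E_k-\frac{\delta}{4}\widetilde E_k+\frac{10\alpha^2QL^2}{\delta}\bigl(\widetilde X_k+\widetilde E_k\bigr)+\alpha^2Q\sigma^2 .$$
   Context: **Problem and algorithm.** $N,d\ge1$ are integers; agent $i\in\{1,\dots,N\}$ has a differentiable objective $f_i:\mathbb{R}^d\to\mathbb{R}$, $f_i(x)=\mathbb{E}[F_i(x;\xi_i)]$, and $f=\frac1N\sum_{i=1}^N f_i$. $\nabla F_i(x;\xi)$ is the stochastic gradient in $x$. Given mixing matrices $W_k=(w_{ij}^k)\in\mathbb{R}^{N\times N}$, stepsize $\alpha>0$, initial points $x_i^0\in\mathbb{R}^d$ and $g_i^0=\nabla F_i(x_i^0;\xi_i^0)$, stochastic gradient tracking is, for $k\ge0$, $$x_i^{k+1}=\sum_{j=1}^N w_{ij}^k(x_j^k-\alpha g_j^k),\qquad g_i^{k+1}=\sum_{j=1}^N w_{ij}^k g_j^k+\nabla F_i(x_i^{k+1};\xi_i^{k+1})-\nabla F_i(x_i^k;\xi_i^k).$$ **Function assumption.** Each $f_i$ is $L$-smooth (gradient $L$-Lipschitz)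 and $\mu$-strongly convex with $0\le\mu\le L$ ($\mu=0$ means convex). $f$ admits a minimizer; $x^\star$ is any (fixed) minimizer of $f$. **Network assumption.** $\{W_k\}_{k\ge0}$ is deterministic and each $W_k$ is nonnegative and doubly stochastic ($W_k\mathbf 1=\mathbf 1$, $\mathbf 1^{\mathsf T}W_k=\mathbf 1^{\mathsf T}$). With $\Pi=\frac1N\mathbf 1\mathbf 1^{\mathsf T}$ and $\widetilde W_k=W_k-\Pi$, there are an integer $\tau\ge1$ and $\lambda\in[0,1)$ with $\|\widetilde W_{k+\tau-1}\cdots\widetilde W_k\|_2\le\lambda$ for all $k\ge0$. Let $\Delta_\lambda=1-\lambda$. **Gradient-noise assumption.** $\mathcal F^k$ is the information ($\sigma$-algebra) available immediately before the samples $\xi_1^k,\dots,\xi_N^k$ are drawn; it contains the initialization and all iterates and samples generated up to iteration $k-1$ (so $x_i^k$ is $\mathcal F^k$-measurable). Conditioned on $\mathcal F^k$, the samples $\xi_1^k,\dots,\xi_N^k$ are mutually independent and, for every $i$, $\mathbb{E}[\nabla F_i(x_i^k;\xi_i^k)-\nabla f_i(x_i^k)\mid\mathcal F^k]=0$ and $\mathbb{E}[\|\nabla F_i(x_i^k;\xi_i^k)-\nabla f_i(x_i^k)\|^2\mid\mathcal F^k]\le\sigma^2$. The initial iterates $x_i^0$ are deterministic. **Notation.** Stack $\mathbf x^k=\mathrm{col}\{x_1^k,\dots,x_N^k\}$, $\mathbf g^k=\mathrm{col}\{g_i^k\}$, $\nabla\mathbf F(\mathbf x^k;\boldsymbol\xi^k)=\mathrm{col}\{\nabla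 F_i(x_i^k;\xi_i^k)\}$, $\nabla\mathbf f(\mathbf x)=\mathrm{col}\{\nabla f_i(x_i)\}$ in $\mathbb{R}^{Nd}$; $\mathbf x^\star=\mathbf 1\otimes x^\star$; $\mathbf\Pi=\Pi\otimes I_d$; $\widetilde{\mathbf W}_k=\widetilde W_k\otimes I_d$; $\bar x^k=\frac1N\sum_i x_i^k$; $\widehat{\mathbf x}^k=(\mathbf I-\mathbf\Pi)\mathbf x^k$; $\mathbf y^k=\mathbf g^k-\nabla\mathbf F(\mathbf x^k;\boldsymbol\xi^k)$; $\widetilde{\mathbf y}^k=\mathbf y^k+\nabla\mathbf f(\mathbf x^\star)$; $\eta=\frac{\Delta_\lambda}{2\tau}$; $\mathbf z^k=\frac{\alpha}{\eta}\widetilde{\mathbf y}^k$; $\delta=\frac{1-\lambda^2}{\tau}$; $Q=1+\frac{8}{\eta^2}=1+\frac{32\tau^2}{\Delta_\lambda^2}$. Let $\mathbf R_k=\delta\sum_{r=0}^\infty\mathbf\Psi(k+r,k)^{\mathsf T}\mathbf\Psi(k+r,k)$ with $\mathbf\Psi(t,s)=\widetilde{\mathbf W}_{t-1}\cdots\widetilde{\mathbf W}_s$ for $t>s$, $\mathbf\Psi(s,s)=\mathbf I$ (the series converges under the network assumption), and $\|\mathbf q\|_{\mathbf R}^2=\mathbf q^{\mathsf T}\mathbf R\mathbf q$. Define $$\widetilde X_k=\mathbb{E}\|\bar x^k-x^\star\|^2,\quad E_k=\tfrac1N\mathbb{E}\bigl[\|\widehat{\mathbf x}^k\|_{\mathbf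 R_k}^2+2\|\mathbf z^k\|_{\mathbf R_k}^2\bigr],\quad \widetilde E_k=\tfrac1N\mathbb{E}\bigl[\|\widehat{\mathbf x}^k\|^2+2\|\mathbf z^k\|^2\bigr].$$ *)

(* Defs.v *)
From HB Require Import structures.
From mathcomp Require Import all_boot all_order all_algebra.
From mathcomp Require Export mxtens.
From mathcomp Require Import all_classical all_reals all_analysis.
Set Implicit Arguments.
Unset Strict Implicit.
Unset Printing Implicit Defensive.
Import Order.TTheory GRing.Theory Num.Theory.
Import numFieldNormedType.Exports.

Local Open Scope classical_set_scope.
Local Open Scope ring_scope.

Section Euclidean.
Context {R : realType}.

(* The norm that MathComp-Analysis puts on matrices is the sup norm. *)
Definition enorm n (v : 'cV[R]_n) : R := Num.sqrt (\sum_i v i ord0 ^+ 2).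

Definition opnorm n (A : 'M[R]_n) : R :=
  sup [set enorm (A *m v) | v in [set v : 'cV[R]_n | enorm v <= 1]].

(* q^T M q *)
Definition wnorm2 n (M : 'M[R]_n) (q : 'cV[R]_n) : R :=
  (q^T *m M *m q) ord0 ord0.

Definition grad n (f : 'cV[R]_n -> R) (x : 'cV[R]_n) : 'cV[R]_n :=
  \col_j 'd f x (delta_mx j ord0).

Definition L_smooth n (L : R) (f : 'cV[R]_n -> R) : Prop :=
  (forall x : 'cV[R]_n, differentiable f x) /\
  (forall x y, enorm (grad f x - grad f y) <= L * enorm (x - y)).

Definition strongly_convex n (mu : R) (f : 'cV[R]_n -> R) : Prop :=
  forall (x y : 'cV[R]_n) (t : R), 0 <= t <= 1 ->
    f (t *: x + (1 - t) *: y) <=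
      t * f x + (1 - t) * f y - mu / 2 * (t * (1 - t)) * enorm (x - y) ^+ 2.

(* col{x_1, ..., x_N}, with the block ordering used by the Kronecker product
   tensmx *)
Definition stack N d (x : 'I_N -> 'cV[R]_d) : 'cV[R]_(N * d) :=
  \col_l x (mxtens_unindex l).1 (mxtens_unindex l).2 ord0.

Definition average N d (x : 'I_N -> 'cV[R]_d) : 'cV[R]_d :=
  N%:R^-1 *: \sum_i x i.

End Euclidean.

Section Conditioning.
Context {dT : measure_display} {T : measurableType dT} {R : realType}.
Variables (P : probability T R) (G : set (set T)).

Definition measurable_wrt dU (U : measurableType dU) (X : T -> U) : Prop :=
  preimage_set_system setT X measurable `<=` G.

Definition measurable_wrt_cV n (X : T -> 'cV[R]_n) : Prop :=
  forall j, measurable_wrt (fun w => X w j ord0).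

(* Y is a version of the conditional expectation E[X | G] *)
Definition is_condexp (X Y : T -> R) : Prop :=
  [/\ P.-integrable setT (EFin \o X), P.-integrable setT (EFin \o Y),
      measurable_wrt Y &
      forall A, G A ->
        (\int[P]_(w in A) (Y w)%:E = \int[P]_(w in A) (X w)%:E)%E].

(* Mutual independence given G of the whole family: the conditional
   probability of a joint event is the product of the conditional
   probabilities. Subfamilies are covered by taking some B i to be setT. As
   versions exist and are almost surely unique, it does not matter which
   versions p i are used. *)
Definition cond_independent (I : finType) (dU : I -> measure_display)
    (U : forall i, measurableType (dU i)) (X : forall i, T -> U i) : Prop :=
  forall B : (forall i, set (U i)), (forall i, measurable (B i)) ->
    exists p : I -> T -> R,
      (forall i, is_condexp \1_(X i @^-1` B i) (p i)) /\
      is_condexp \1_(\bigcap_(i in [set: I]) (X i @^-1` B i))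
                 (fun w => \prod_i p i w).

End Conditioning.

Section Network.
Context {R : realType}.

(* trans_prod A s m = A (s + m - 1) *m ... *m A s, the identity if m = 0 *)
Fixpoint trans_prod n (A : nat -> 'M[R]_n) (s m : nat) : 'M[R]_n :=
  if m is m'.+1 then A (s + m')%N *m trans_prod A s m' else 1%:M.

Definition avg_mx N : 'M[R]_N := const_mx N%:R^-1.

Definition Wtilde N (W : nat -> 'M[R]_N) (k : nat) : 'M[R]_N := W k - avg_mx N.

Record network_assumption N (W : nat -> 'M[R]_N) (tau : nat) (lam : R) : Prop :=
  NetworkAssumption {
    network_nonneg : forall k i j, 0 <= W k i j;
    network_row : forall k, W k *m (const_mx 1 : 'cV[R]_N) = const_mx 1;
    network_col : forall k, (const_mx 1 : 'rV[R]_N) *m W k = const_mx 1;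
    network_tau : (1 <= tau)%N;
    network_lam : 0 <= lam < 1;
    network_contract : forall k, opnorm (trans_prod (Wtilde W) k tau) <= lam
  }.

Definition eta_of (tau : nat) (lam : R) : R := (1 - lam) / (2 * tau%:R).
Definition delta_of (tau : nat) (lam : R) : R := (1 - lam ^+ 2) / tau%:R.
Definition Q_of (tau : nat) (lam : R) : R := 1 + 8 / eta_of tau lam ^+ 2.

Definition bWtilde N d (W : nat -> 'M[R]_N) (k : nat) : 'M[R]_(N * d) :=
  tensmx (Wtilde W k) (1%:M : 'M[R]_d).

Definition bPi N d : 'M[R]_(N * d) := tensmx (avg_mx N) (1%:M : 'M[R]_d).

Definition Rmx N d (W : nat -> 'M[R]_N) (tau : nat) (lam : R) (k : nat) :
    'M[R]_(N * d) :=
  delta_of tau lam *: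
    limn (series (fun r => (trans_prod (bWtilde d W) k r)^T
                           *m trans_prod (bWtilde d W) k r)).

End Network.

Section StochasticGradientTracking.
Context {R : realType} {N d : nat}.
Context {dT : measure_display} {T : measurableType dT}.
Context {dX : 'I_N -> measure_display} {Xi : forall i, measurableType (dX i)}.
Variable P : probability T R.
Variables (F : forall i, 'cV[R]_d -> Xi i -> R).
Variable D : forall i, probability (Xi i) R.
Variable xi : nat -> forall i, {mfun T >-> Xi i}.
Variable W : nat -> 'M[R]_N.
Variables (tau : nat) (lam alpha : R) (xs : 'cV[R]_d).
Variables x g : nat -> 'I_N -> T -> 'cV[R]_d.

Definition objective (i : 'I_N) (u : 'cV[R]_d) : R :=
  \int[D i]_(s in setT) F u s.

Definition global_objective (u : 'cV[R]_d) : R :=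
  N%:R^-1 * \sum_i objective i u.

(* The expectation defining f_i and the gradient nabla F_i(.; s) exist. The
   joint measurability of (u, s) |-> nabla F_i(u; s) follows. *)
Definition stochastic_objective : Prop :=
  (forall i u, (D i).-integrable setT (EFin \o (F u : Xi i -> R))) /\
  (forall i (u : 'cV[R]_d) (s : Xi i), differentiable (fun v => F v s) u).

(* nabla F_i(x_i^k; xi_i^k) *)
Definition sgrad (k : nat) (i : 'I_N) (w : T) : 'cV[R]_d :=
  grad (fun u => F u (xi k i w)) (x k i w).

Definition sgt_iteration (x0 : 'I_N -> 'cV[R]_d) : Prop :=
  [/\ forall i w, x 0%N i w = x0 i,
      forall i w, g 0%N i w = sgrad 0 i w,
      forall k i w,
        x k.+1 i w = \sum_j W k i j *: (x k j w - alpha *: g k j w) &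
      forall k i w,
        g k.+1 i w = \sum_j W k i j *: g k j w + sgrad k.+1 i w - sgrad k i w].

Definition grad_noise (k : nat) (i : 'I_N) (w : T) : 'cV[R]_d :=
  sgrad k i w - grad (objective i) (x k i w).

Record noise_assumption (Fk : nat -> set (set T)) (sigma : R) : Prop :=
  NoiseAssumption {
    noise_sigma_algebra : forall k, sigma_algebra setT (Fk k);
    noise_sub : forall k, Fk k `<=` measurable;
    noise_samples : forall k l i, (l < k)%N -> measurable_wrt (Fk k) (xi l i);
    noise_iterates : forall k l i, (l < k)%N ->
      measurable_wrt_cV (Fk k) (x l i) /\ measurable_wrt_cV (Fk k) (g l i);
    noise_indep : forall k, cond_independent P (Fk k) (fun i => xi k i);
    noise_unbiased : forall k i j,
      is_condexp P (Fk k) (fun w => grad_noise k i w j ord0) (cst 0);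
    noise_variance : forall k i,
      exists2 V : T -> R,
        is_condexp P (Fk k) (fun w => enorm (grad_noise k i w) ^+ 2) V &
        {ae P, forall w, V w <= sigma ^+ 2}
  }.

Definition xhat (k : nat) (w : T) : 'cV[R]_(N * d) :=
  (1%:M - bPi N d) *m stack (fun i => x k i w).

Definition yvec (k : nat) (w : T) : 'cV[R]_(N * d) :=
  stack (fun i => g k i w) - stack (fun i => sgrad k i w).

Definition ytilde (k : nat) (w : T) : 'cV[R]_(N * d) :=
  yvec k w + stack (fun i => grad (objective i) xs).

Definition zvec (k : nat) (w : T) : 'cV[R]_(N * d) :=
  (alpha / eta_of tau lam) *: ytilde k w.

Definition Xtilde (k : nat) : \bar R :=
  ('E_P[fun w => (enorm (average (fun i => x k i w) - xs) ^+ 2)%R])%E.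

Definition Elyap (k : nat) : \bar R :=
  ((N%:R^-1)%:E *
   'E_P[fun w => (wnorm2 (Rmx d W tau lam k) (xhat k w)
                  + 2 * wnorm2 (Rmx d W tau lam k) (zvec k w))%R])%E.

Definition Etilde (k : nat) : \bar R :=
  ((N%:R^-1)%:E *
   'E_P[fun w => (enorm (xhat k w) ^+ 2 + 2 * enorm (zvec k w) ^+ 2)%R])%E.

End StochasticGradientTracking.

(* Main.v *)
Require Import Defs.
From HB Require Import structures.
From mathcomp Require Import all_boot all_order all_algebra.
From mathcomp Require Import ring lra.
From mathcomp Require Import all_classical all_reals all_analysis.
From mathcomp Require Import measurable_realfun.
Set Implicit Arguments.
Unset Strict Implicit.
Unset Printing Implicit Defensive.
Import Order.TTheory GRing.Theory Num.Theory.
Import numFieldNormedType.Exports.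

Local Open Scope classical_set_scope.
Local Open Scope ring_scope.

(** The iteration splits into the mean of the iterates and the deviations from
    consensus, and each of the two inequalities is an energy balance for one
    part.

    The mean. The mixing matrices are doubly stochastic and the trackers always
    sum to the current sampled gradients ([sum_tracker]), so the mean iterate
    makes one gradient step, along the mean of the sampled gradients at the
    local iterates. With the exact gradients this step multiplies the squared
    distance to the minimizer by at most [1 - mu * alpha], up to the squared
    consensus error ([mean_gradient_step]): the inner product is bounded below
    by smoothness towards the mean and strong convexity towards the minimizer,
    and the squared gradient is absorbed by the objective gap. The noise is
    centred given the past, so no cross term survives in expectation. The
    noises of different agents are orthogonal, so the variance of their mean is
    at most [sigma ^+ 2 / N].

    The deviations. Shifting the tracking error by the gradients at the
    minimizer makes it mean-free, because these gradients sum to zero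
    ([gbar_minimizer]). Both the consensus error and the shifted tracking error
    are then multiplied by the centred mixing matrix and perturbed by gradient
    increments and noise ([centered_step], [tracking_step]). The matrices
    [Rmx k] solve the Lyapunov equation
    [R_k = delta I + Wt_k^T R_(k+1) Wt_k] ([Rmx_lyapunov]) and lie between
    [0] and the identity ([Rmx_ge0], [Rmx_le]). A step without perturbation thus
    loses [delta] times the squared norm. Young's inequality spends part of this
    loss on the coupling of the two errors and on the gradient increments
    ([lyapunov_drift]), which are controlled by the Lipschitz constant; the
    noise adds its own energy ([lyapunov_noise]).

    The probability. The noise of an agent is a function of its iterate, known
    from the past, and of its current sample. Its measurability with respect to
    this pair is the Caratheodory argument of [measurable_caratheodory] and
    [measurable_grad]. Conditional independence is a product rule for events;
    [cond_indep_orthogonal] extends it to the noises by a pi-lambda argument and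
    simple functions ([pi_system_Ex_eq0], [Ex_mul_eq0]). All iterates are square
    integrable ([sqr_iterates]), so the extended-real statement reduces to
    inequalities between real expectations. *)

(** * Inner products of column vectors *)

Section Dot.
Context {R : realType}.

Definition dot n (u v : 'cV[R]_n) : R := \sum_i u i ord0 * v i ord0.

Lemma dotC n (u v : 'cV[R]_n) : dot u v = dot v u.
Proof. by apply: eq_bigr => i _; rewrite mulrC. Qed.

Lemma dotDl n (u v w : 'cV[R]_n) : dot (u + v) w = dot u w + dot v w.
Proof. by rewrite -big_split; apply: eq_bigr => i _; rewrite mxE mulrDl. Qed.

Lemma dotZl n a (u w : 'cV[R]_n) : dot (a *: u) w = a * dot u w.
Proof. by rewrite mulr_sumr; apply: eq_bigr => i _; rewrite mxE mulrA. Qed.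

Lemma dotNl n (u w : 'cV[R]_n) : dot (- u) w = - dot u w.
Proof. by rewrite -scaleN1r dotZl mulN1r. Qed.

Lemma dotBl n (u v w : 'cV[R]_n) : dot (u - v) w = dot u w - dot v w.
Proof. by rewrite dotDl dotNl. Qed.

Lemma dotDr n (u v w : 'cV[R]_n) : dot w (u + v) = dot w u + dot w v.
Proof. by rewrite !(dotC w) dotDl. Qed.

Lemma dotZr n a (u w : 'cV[R]_n) : dot w (a *: u) = a * dot w u.
Proof. by rewrite !(dotC w) dotZl. Qed.

Lemma dotNr n (u w : 'cV[R]_n) : dot w (- u) = - dot w u.
Proof. by rewrite !(dotC w) dotNl. Qed.

Lemma dotBr n (u v w : 'cV[R]_n) : dot w (u - v) = dot w u - dot w v.
Proof. by rewrite !(dotC w) dotBl. Qed.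

Definition dotE := (dotDl, dotDr, dotNl, dotNr, dotZl, dotZr).

Lemma dot0l n (w : 'cV[R]_n) : dot 0 w = 0.
Proof. by rewrite -(scale0r 0) dotZl mul0r. Qed.

Lemma dot_suml n (I : finType) (u : I -> 'cV[R]_n) w :
  dot (\sum_i u i) w = \sum_i dot (u i) w.
Proof.
apply: (big_ind2 (fun a b => dot a w = b)) => //; first exact: dot0l.
by move=> ? ? ? ? <- <-; rewrite dotDl.
Qed.

Lemma dot_ge0 n (u : 'cV[R]_n) : 0 <= dot u u.
Proof. by apply: sumr_ge0 => i _; rewrite -expr2 sqr_ge0. Qed.

Lemma dot_eq0 n (u : 'cV[R]_n) : dot u u <= 0 -> u = 0.
Proof.
move=> u0; have /eqP : dot u u = 0 by apply/eqP; rewrite eq_le u0 dot_ge0.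
rewrite psumr_eq0 => [/allP h|i _]; last by rewrite -expr2 sqr_ge0.
apply/colP => i; rewrite mxE; have := h i (mem_index_enum _).
by rewrite -expr2 sqrf_eq0 => /eqP.
Qed.

Lemma enorm_sq n (u : 'cV[R]_n) : enorm u ^+ 2 = dot u u.
Proof.
rewrite sqr_sqrtr; first by apply: eq_bigr => i _; rewrite expr2.
by apply: sumr_ge0 => i _; rewrite sqr_ge0.
Qed.

Lemma enorm_ge0 n (u : 'cV[R]_n) : 0 <= enorm u.
Proof. exact: sqrtr_ge0. Qed.

(** Young's inequality, used wherever Cauchy-Schwarz would be. *)
Lemma dot_young n a (u v : 'cV[R]_n) : 0 < a ->
  2 * dot u v <= a * dot u u + a^-1 * dot v v.
Proof.
move=> a0; have := dot_ge0 (a *: u - v); rewrite !dotE (dotC v u) => h.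
have : 0 <= a^-1 * (a * (a * dot u u) - 2 * a * dot u v + dot v v).
  by apply: mulr_ge0; [rewrite invr_ge0 ltW | lra].
have -> : a^-1 * (a * (a * dot u u) - 2 * a * dot u v + dot v v)
  = a * dot u u - 2 * dot u v + a^-1 * dot v v by field; rewrite gt_eqF.
lra.
Qed.

Lemma dotD_le2 n (u v : 'cV[R]_n) :
  dot (u + v) (u + v) <= 2 * dot u u + 2 * dot v v.
Proof.
by have := @dot_young _ 1 u v ltr01; rewrite !dotE (dotC v u) invr1; lra.
Qed.

(** Jensen's inequality for the squared norm. *)
Lemma dot_average_le N n (u : 'I_N -> 'cV[R]_n) : (0 < N)%N ->
  dot (average u) (average u) <= N%:R^-1 * \sum_i dot (u i) (u i).
Proof.
move=> N0; set a := average u.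
have Ni : (N%:R : R) != 0 by rewrite pnatr_eq0 -lt0n.
have aE : \sum_i u i = N%:R *: a by rewrite /a /average scalerA divff// scale1r.
clearbody a.
have : 0 <= N%:R^-1 * \sum_i dot (u i - a) (u i - a).
  by rewrite mulr_ge0 ?invr_ge0 ?ler0n// sumr_ge0 // => i _; exact: dot_ge0.
rewrite (eq_bigr (fun i => dot (u i) (u i) - 2 * dot (u i) a + dot a a)); last first.
  by move=> i _; rewrite !dotE (dotC a); ring.
rewrite !big_split /= sumrN -mulr_sumr -dot_suml sumr_const card_ord -[dot _ _ *+ N]mulr_natr.
rewrite aE dotZl; set s := \sum_i _; set t := dot a a => h.
rewrite -subr_ge0 (_ : _ - _ = N%:R^-1 * (s - 2 * (N%:R * t) + t * N%:R)) //.
by field.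
Qed.

(** The variance decomposition around the mean. *)
Lemma sum_dot_average N n (u : 'I_N -> 'cV[R]_n) c : (0 < N)%N ->
  \sum_i dot (u i - c) (u i - c) =
  N%:R * dot (average u - c) (average u - c) +
  \sum_i dot (u i - average u) (u i - average u).
Proof.
move=> N0; set a := average u.
have Ni : (N%:R : R) != 0 by rewrite pnatr_eq0 -lt0n.
have aE : \sum_i u i = N%:R *: a by rewrite /a /average scalerA divff// scale1r.
clearbody a.
have E : forall b, \sum_i dot (u i - b) (u i - b) =
  \sum_i dot (u i) (u i) - 2 * N%:R * dot a b + N%:R * dot b b.
  move=> b; rewrite (eq_bigr (fun i => dot (u i) (u i) - 2 * dot (u i) b + dot b b)).
    rewrite !big_split /= sumrN -mulr_sumr -dot_suml sumr_const card_ord -[dot _ _ *+ N]mulr_natr.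
    by rewrite aE dotZl; ring.
  by move=> i _; rewrite !dotE (dotC b); ring.
by rewrite !E !dotE (dotC c a); ring.
Qed.

End Dot.

(** * Gradients of smooth and strongly convex functions *)

Section Gradient.
Context {R : realType} {n : nat}.
Implicit Types (f : 'cV[R]_n -> R) (x y h : 'cV[R]_n).

Lemma diff_grad f x h : differentiable f x -> 'd f x h = dot (grad f x) h.
Proof.
move=> fx; have lf : linear ('d f x) by move=> a u v; exact: linearP.
rewrite {1}(_ : h = \sum_j h j ord0 *: delta_mx j ord0).
  rewrite linear_sum; apply: eq_bigr => j _.
  by rewrite linearZ /= mxE mulrC.
by rewrite {1}[h]matrix_sum_delta; apply: eq_bigr => i _; rewrite big_ord1.
Qed.

Lemma is_derive_segment f x h t : differentiable f (x + t *: h) ->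
  is_derive t 1 (fun s : R => f (x + s *: h)) (dot (grad f (x + t *: h)) h).
Proof.
move=> df; have E : (fun s : R^o => s^-1 *: ((fun s : R => f (x + s *: h)) (s *: (1:R) + t)
       - (fun s : R => f (x + s *: h)) t)) =
   (fun s => s^-1 *: (f (s *: h + (x + t *: h)) - f (x + t *: h))).
  apply/funext => s /=; congr (_ *: (f _ - _)).
  by rewrite [s *: 1]mulr1 scalerDl addrCA.
have dfh : derivable f (x + t *: h) h by exact: diff_derivable.
have dd : derivable (fun s : R => f (x + s *: h)) t 1.
  by rewrite /derivable E.
apply: (DeriveDef dd).
rewrite -diff_grad // -deriveE // /derive.
by rewrite E.
Qed.

(** The function minus its quadratic model has nonpositive slope along the
    segment, so the mean value theorem bounds its increment. *)
Lemma descent_lemma (L : R) f x y : 0 < L -> L_smooth L f ->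
  f y <= f x + dot (grad f x) (y - x) + L / 2 * dot (y - x) (y - x).
Proof.
move=> L0 [df lipf]; set h := y - x.
have xh : x + h = y by rewrite addrC subrK.
clearbody h.
(* the gradient is generalized once the derivative of [phi] is known *)
pose G := grad f; rewrite -/G in lipf *.
pose phi (t : R) : R := f (x + t *: h) - t * dot (G x) h
                    - t ^+ 2 * (L / 2 * dot h h).
have dphi (t : R) : is_derive t 1 phi (dot (G (x + t *: h)) h
    - dot (G x) h - t * (L * dot h h)).
  have := is_derive_segment (df (x + t *: h)); rewrite -/G => d1.
  rewrite /phi; apply: is_derive_eq.
  have E (a b c s : R) : a - (s * 0 + b * 1) -
      (s ^+ 2 * 0 + L / 2 * c * (s * 1 + s * 1)) = a - b - s * (L * c).
    by field.
  exact: E.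
clearbody G.
have cphi : {within `[0, 1], continuous phi}.
  apply: derivable_within_continuous => t _.
  by case: (dphi t).
have [c] := MVT ltr01 (fun t _ => dphi t) cphi.
rewrite in_itv /= => /andP[c0 c1].
rewrite /phi scale1r scale0r addr0 mul0r expr1n expr0n /= subr0 mul0r subr0.
clear cphi dphi phi.
rewrite !mul1r subr0 mulr1 xh.
have Lc0 : 0 < L * c by apply: mulr_gt0.
have := dot_young (G (x + c *: h) - G x) h.
move=> /(_ (L * c)^-1); rewrite invr_gt0 invrK => /(_ Lc0) Y.
have : dot (G (x + c *: h) - G x) (G (x + c *: h) - G x)
    <= (L * c) ^+ 2 * dot h h.
  have -> : (L * c) ^+ 2 * dot h h = (L * enorm (c *: h)) ^+ 2.
    by rewrite !exprMn enorm_sq (dotZl c h) (dotZr c h) !expr2 !mulrA.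
  rewrite -enorm_sq ler_sqr ?nnegrE ?enorm_ge0 //; last first.
    by rewrite mulr_ge0 ?enorm_ge0 // ltW.
  by have := lipf (x + c *: h) x; rewrite [x + _]addrC addrK.
move=> lip.
have {}lip : (L * c)^-1 * dot (G (x + c *: h) - G x)
    (G (x + c *: h) - G x) <= L * c * dot h h.
  by rewrite ler_pdivrMl // mulrA -expr2.
rewrite (dotBl _ _ h) in Y => E.
lra.
Qed.

(** Divide the convexity inequality at [x + t (y - x)] by [t] and let [t] tend
    to 0 from the right. *)
Lemma strongly_convex_grad (mu : R) f x y : strongly_convex mu f ->
  differentiable f x ->
  f x + dot (grad f x) (y - x) + mu / 2 * dot (y - x) (y - x) <= f y.
Proof.
move=> cf df; set h := y - x.
have hE : h = y - x by []. clearbody h.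
have df0 : differentiable f (x + 0 *: h) by rewrite scale0r addr0.
have := is_derive_segment df0; rewrite scale0r addr0 => -[dv dvE].
set phi := (fun s : R => f (x + s *: h)) in dv dvE.
have cv : (fun t : R => t^-1 * (phi t - phi 0)) @ 0^'+ --> dot (grad f x) h.
  rewrite -dvE; have := dv; rewrite /derivable => /cvg_ex [l cvl].
  have -> : 'D_1 phi 0 = l by apply/cvg_lim.
  have E : (fun t : R => t^-1 * (phi t - phi 0)) =
     (fun t : R => t^-1 *: (phi (t *: (1 : R) + 0) - phi 0)).
    by apply: funext => t; rewrite addr0 [t *: 1]mulr1.
  by rewrite E; exact: cvg_dnbhs_at_right cvl.
have cr : (fun t : R => f y - f x - mu / 2 * (1 - t) * dot h h) @ 0^'+ -->
     f y - f x - mu / 2 * (1 - 0) * dot h h.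
  apply: cvg_at_right_filter.
  apply: cvgB; first exact: cvg_cst.
  apply: cvgMl; apply: cvgMr; apply: cvgB; [exact: cvg_cst|exact: cvg_id].
suff : dot (grad f x) h <= f y - f x - mu / 2 * (1 - 0) * dot h h by lra.
apply: (ler_cvg_to cv cr).
near=> t.
have t0 : 0 < t by near: t; exact: nbhs_right_gt.
have t1 : t < 1 by near: t; exact: nbhs_right_lt.
rewrite -(ler_pM2l t0) mulrA divff ?gt_eqF // mul1r /phi scale0r addr0.
have := cf y x t; rewrite (ltW t0) (ltW t1) => /(_ isT).
rewrite (_ : t *: y + (1 - t) *: x = x + t *: h); last first.
  by rewrite hE scalerBl scale1r scalerBr addrCA.
rewrite enorm_sq -hE; lra.
Unshelve. all: by end_near.
Qed.

Lemma L_smooth_sq (L : R) f x y : 0 <= L -> L_smooth L f ->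
  dot (grad f x - grad f y) (grad f x - grad f y) <=
  L ^+ 2 * dot (x - y) (x - y).
Proof.
move=> L0 [_ /(_ x y) lip].
rewrite -!enorm_sq -exprMn ler_sqr ?nnegrE ?enorm_ge0 //.
by rewrite mulr_ge0 ?enorm_ge0.
Qed.

End Gradient.

(** * One gradient step of the mean iterate *)

Section MeanDescent.
Context {R : realType} {N d : nat}.
Variables (f : 'I_N -> 'cV[R]_d -> R) (gr : 'I_N -> 'cV[R]_d -> 'cV[R]_d)
  (L mu : R) (xs : 'cV[R]_d).
Hypotheses (N0 : (0 < N)%N) (L0 : 0 < L) (mu0 : 0 <= mu).
Hypothesis gr_descent : forall i u v,
  f i v <= f i u + dot (gr i u) (v - u) + L / 2 * dot (v - u) (v - u).
Hypothesis gr_convex : forall i u v,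
  f i u + dot (gr i u) (v - u) + mu / 2 * dot (v - u) (v - u) <= f i v.
Hypothesis gr_lipschitz : forall i u v,
  dot (gr i u - gr i v) (gr i u - gr i v) <= L ^+ 2 * dot (u - v) (u - v).
Hypothesis xs_min : forall u, N%:R^-1 * \sum_i f i xs <= N%:R^-1 * \sum_i f i u.

Let fbar u := N%:R^-1 * \sum_i f i u.
Let gbar u := average (fun i => gr i u).

Let Ni : (N%:R : R) != 0.
Proof. by rewrite pnatr_eq0 -lt0n. Qed.

Let Nv0 : (0 : R) <= N%:R^-1.
Proof. by rewrite invr_ge0 ler0n. Qed.

Let mean_cst (c : R) : N%:R^-1 * \sum_(i < N) c = c.
Proof. by rewrite sumr_const card_ord -[c *+ N]mulr_natl mulKf. Qed.

(** A gradient step of length [1 / L] decreases the mean objective by at least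
    this multiple of the squared gradient, and it cannot go below the
    minimum. *)
Lemma gbar_sq_le u : dot (gbar u) (gbar u) <= 2 * L * (fbar u - fbar xs).
Proof.
have D y : fbar y <= fbar u + dot (gbar u) (y - u) + L / 2 * dot (y - u) (y - u).
  rewrite /gbar /average dotZl dot_suml -(mean_cst (L / 2 * _)) /fbar -!mulrDr.
  rewrite -!big_split ler_wpM2l //; apply: ler_sum => i _.
  exact: gr_descent.
move: (gbar u) D => G D.
have := le_trans (xs_min (u - L^-1 *: G)) (D _); rewrite -/(fbar xs).
have -> : u - L^-1 *: G - u = - (L^-1 *: G) by rewrite addrAC subrr add0r.
rewrite !dotE => h.
have : L^-1 * dot G G <= 2 * (fbar u - fbar xs).
  have : L / 2 * - - (L^-1 * (L^-1 * dot G G)) =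
    L^-1 * dot G G / 2 by field; rewrite gt_eqF.
  lra.
by rewrite -(ler_pM2l L0) mulrA divff ?gt_eqF// mul1r mulrA (mulrC L 2).
Qed.

Lemma gbar_minimizer : gbar xs = 0.
Proof. by apply: dot_eq0; apply: le_trans (gbar_sq_le _) _; rewrite subrr mulr0. Qed.

Variables (alpha : R) (x : 'I_N -> 'cV[R]_d).
Hypothesis (halpha : 0 < alpha <= 1 / (4 * L)).

Let xb := average x.
Let ghat := average (fun i => gr i (x i)).
Let dev := N%:R^-1 * \sum_i dot (x i - xb) (x i - xb).

Let gap_le_inner : fbar xb - fbar xs + mu / 2 * dot (xb - xs) (xb - xs)
  - L / 2 * dev <= dot (xb - xs) ghat.
Proof.
have E : N%:R^-1 * \sum_i (f i xb - f i xs
     + mu / 2 * dot (x i - xs) (x i - xs) - L / 2 * dot (x i - xb) (x i - xb))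
  <= dot (xb - xs) ghat.
  rewrite dotC /ghat /average dotZl dot_suml ler_wpM2l //; apply: ler_sum => i _.
  have := gr_descent i (x i) xb.
  have := gr_convex i (x i) xs.
  rewrite -[x i - xs]opprB -[x i - xb]opprB !dotNl !dotNr !opprK.
  have -> : dot (gr i (x i)) (xb - xs) =
    dot (gr i (x i)) (xb - x i) - dot (gr i (x i)) (xs - x i).
    by rewrite -dotBr opprB addrA subrK.
  lra.
apply: le_trans E; rewrite !big_split /= !sumrN -!mulr_sumr.
rewrite (sum_dot_average x xs N0) -/xb.
rewrite !mulrDr !mulrN -/(fbar xb) -/(fbar xs).
have -> : N%:R^-1 * (L / 2 * (\sum_i dot (x i - xb) (x i - xb))) = L / 2 * dev.
  by rewrite mulrCA.
rewrite lerD2r lerD2l -[leLHS]addr0 lerD //.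
  by rewrite le_eqVlt; apply/orP; left; apply/eqP; field.
by rewrite !mulr_ge0 // sumr_ge0 // => i _; exact: dot_ge0.
Qed.

Let ghat_sq_le : dot ghat ghat <= 4 * L * (fbar xb - fbar xs) + 2 * L ^+ 2 * dev.
Proof.
have -> : ghat = gbar xb + average (fun i => gr i (x i) - gr i xb).
  by rewrite /ghat /gbar /average sumrB scalerBr addrC subrK.
apply: (le_trans (dotD_le2 _ _)); have := gbar_sq_le xb.
have : dot (average (fun i => gr i (x i) - gr i xb))
   (average (fun i => gr i (x i) - gr i xb)) <= L ^+ 2 * dev.
  apply: le_trans (dot_average_le _ N0) _.
  rewrite /dev mulrCA ler_wpM2l // mulr_sumr; apply: ler_sum => i _.
  exact: gr_lipschitz.
lra.
Qed.

(** The gradients are taken at the local iterates, so the inner product with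
    [xb - xs] is bounded below by descent towards [xb] plus convexity towards
    [xs]; the squared gradient is absorbed by the objective gap because
    [4 * alpha * L <= 1]. *)
Lemma mean_gradient_step :
  dot (xb - xs - alpha *: ghat) (xb - xs - alpha *: ghat) <=
  (1 - mu * alpha) * dot (xb - xs) (xb - xs) + 3 * alpha * L / 2 * dev.
Proof.
have /andP[a0 a1] := halpha.
have aL : 4 * alpha * L <= 1.
  move: a1; rewrite ler_pdivlMr; last by rewrite mulr_gt0.
  lra.
have gap0 : 0 <= fbar xb - fbar xs by rewrite subr_ge0; exact: xs_min.
have dev0 : 0 <= dev by rewrite mulr_ge0 // sumr_ge0 // => i _; exact: dot_ge0.
move: ghat_sq_le gap_le_inner; move: ghat (xb - xs) dev dev0 => gh v e e0.
rewrite !dotE (dotC gh v); set a := dot v v; set b := dot v gh.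
set c := dot gh gh; set h := fbar xb - fbar xs in gap0 *.
move=> h1 h2.
have : alpha ^+ 2 * c <= alpha ^+ 2 * (4 * L * h + 2 * L ^+ 2 * e).
  by rewrite ler_wpM2l // sqr_ge0.
have : alpha * (h + mu / 2 * a - L / 2 * e) <= alpha * b.
  by rewrite ler_pM2l.
have aL0 : 0 <= 1 - 4 * alpha * L by rewrite subr_ge0.
have : 0 <= alpha * h * (1 - 4 * alpha * L).
  by rewrite !mulr_ge0 // (ltW a0).
have : 0 <= alpha * L * e * (1 - 4 * alpha * L).
  by rewrite !mulr_ge0 // ?(ltW a0) ?(ltW L0).
have : 0 <= alpha * h by rewrite mulr_ge0 // ltW.
lra.
Qed.

End MeanDescent.

(** * Quadratic forms and limits of symmetric matrices *)

Section QuadraticForm.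
Context {R : realType} {n : nat}.
Implicit Types (M : 'M[R]_n) (u v q : 'cV[R]_n).

Lemma wnorm2E M q : wnorm2 M q = dot q (M *m q).
Proof.
by rewrite /wnorm2 -mulmxA mxE; apply: eq_bigr => i _; rewrite mxE.
Qed.

Lemma wnorm2_sum M q :
  wnorm2 M q = \sum_i q i ord0 * \sum_j M i j * q j ord0.
Proof. by rewrite wnorm2E; apply: eq_bigr => i _; rewrite mxE. Qed.

Lemma wnorm2D M u v :
  wnorm2 M (u + v) = wnorm2 M u + wnorm2 M v + (dot u (M *m v) + dot v (M *m u)).
Proof. by rewrite !wnorm2E mulmxDr dotDl !dotDr; ring. Qed.

Lemma wnorm2Z M a u : wnorm2 M (a *: u) = a ^+ 2 * wnorm2 M u.
Proof. by rewrite !wnorm2E -scalemxAr dotZl dotZr mulrA -expr2. Qed.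

Lemma wnorm2N M u : wnorm2 M (- u) = wnorm2 M u.
Proof. by rewrite -scaleN1r wnorm2Z sqrrN expr1n mul1r. Qed.

Lemma wnorm2_young M u v a : 0 < a -> (forall q, 0 <= wnorm2 M q) ->
  wnorm2 M (u + v) <= (1 + a) * wnorm2 M u + (1 + a^-1) * wnorm2 M v.
Proof.
move=> a0 M0; have := M0 (a *: u - v).
rewrite !wnorm2D wnorm2N wnorm2Z mulmxN -scalemxAr dotNr dotZl dotNl dotZr.
move: (wnorm2 M u) (wnorm2 M v) (dot u _) (dot v _) => A B C D h.
suff : C + D <= a * A + a^-1 * B by lra.
rewrite -(ler_pM2l a0) (_ : a * (a * A + a^-1 * B) = a ^+ 2 * A + B); first lra.
by field; rewrite gt_eqF.
Qed.

Lemma dot_mulmx m (A : 'M[R]_(m, n)) u (w : 'cV_m) :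
  dot (A *m u) w = dot u (A^T *m w).
Proof.
transitivity (((A *m u)^T *m w) ord0 ord0).
  by rewrite [RHS]mxE; apply: eq_bigr => i _; rewrite [_^T _ _]mxE.
by rewrite trmx_mul -mulmxA mxE; apply: eq_bigr => i _; rewrite [_^T _ _]mxE.
Qed.

Lemma wnorm2_gram (A : 'M[R]_n) q : wnorm2 (A^T *m A) q = dot (A *m q) (A *m q).
Proof. by rewrite wnorm2E dot_mulmx mulmxA. Qed.

Lemma dot_delta i v : dot (delta_mx i ord0) v = v i ord0.
Proof.
rewrite /dot (bigD1 i) //= mxE !eqxx mul1r big1 ?addr0 // => j ji.
by rewrite mxE (negPf ji) mul0r.
Qed.

Lemma dot_delta_mulmx M i j :
  dot (delta_mx i ord0) (M *m delta_mx j ord0) = M i j.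
Proof. by rewrite dot_delta -colE mxE. Qed.

Lemma wnorm2_polar M i j : M^T = M ->
  M i j = (wnorm2 M (delta_mx i ord0 + delta_mx j ord0)
           - wnorm2 M (delta_mx i ord0) - wnorm2 M (delta_mx j ord0)) / 2.
Proof.
move=> sM; have E : M j i = M i j by rewrite -[in LHS]sM mxE.
by rewrite wnorm2D !dot_delta_mulmx E; field.
Qed.

End QuadraticForm.

Section MatrixLimit.
Context {R : realType} {n : nat}.

Lemma cvg_mx m (S : nat -> 'M[R]_(m, n)) (M : 'M[R]_(m, n)) :
  (forall i j, (fun k => S k i j) @ \oo --> M i j) -> S @ \oo --> M.
Proof.
move=> SM A [B BM BA].
suff : \forall k \near \oo, forall i j, B i j (S k i j).
  by apply: filterS => k kB; exact: BA.
apply: filter_forall => i; apply: filter_forall => j.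
exact: SM (BM i j).
Qed.

Lemma cvgn_sum (I : finType) (u : I -> nat -> R) (l : I -> R) :
  (forall i, u i @ \oo --> l i) ->
  (fun k => \sum_i u i k) @ \oo --> \sum_i l i.
Proof.
move=> ul; apply: cvg_big => //; exact: add_continuous.
Qed.

(** Polarization turns convergence of the quadratic forms into convergence of
    the entries. *)
Lemma cvg_wnorm2_lim (S : nat -> 'M[R]_n) : (forall k, (S k)^T = S k) ->
  (forall q, cvgn (fun k => wnorm2 (S k) q)) ->
  forall q, (fun k => wnorm2 (S k) q) @ \oo --> wnorm2 (limn S) q.
Proof.
move=> sS cS.
pose M : 'M[R]_n := \matrix_(i, j) limn (fun k => S k i j).
have cE i j : (fun k => S k i j) @ \oo --> M i j.
  have c : cvgn (fun k => S k i j).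
    have -> : (fun k => S k i j) = (fun k => (wnorm2 (S k) (delta_mx i ord0 + delta_mx j ord0)
       - wnorm2 (S k) (delta_mx i ord0) - wnorm2 (S k) (delta_mx j ord0)) / 2).
      by apply/funext => k; apply: wnorm2_polar.
    by apply: is_cvgMl; apply: is_cvgB => //; apply: is_cvgB.
  by rewrite mxE.
have -> : limn S = M by apply/cvg_lim => //; exact: cvg_mx.
move=> q; rewrite wnorm2_sum.
under eq_fun do rewrite wnorm2_sum.
apply: (@cvgn_sum _ (fun i k => q i ord0 * \sum_j S k i j * q j ord0)) => i.
apply: cvgMr; apply: (@cvgn_sum _ (fun j k => S k i j * q j ord0)) => j.
exact: cvgMl.
Qed.

End MatrixLimit.

(** * Kronecker products with the identity *)

Section TransProd.
Context {R : realType} {n : nat}.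
Implicit Types (A : nat -> 'M[R]_n).

Lemma trans_prodD A s m m' :
  trans_prod A s (m + m') = trans_prod A (s + m) m' *m trans_prod A s m.
Proof.
elim: m' => [|m' IH]; first by rewrite addn0 /= mul1mx.
by rewrite addnS /= IH mulmxA addnA.
Qed.

Lemma trans_prodSr A s m :
  trans_prod A s m.+1 = trans_prod A s.+1 m *m A s.
Proof. by rewrite -add1n trans_prodD addn1 /= mulmx1 addn0. Qed.

End TransProd.

Section Kronecker.
Context {R : realType} {N d : nat}.

Lemma stackE (x : 'I_N -> 'cV[R]_d) i a :
  stack x (mxtens_index (i, a)) ord0 = x i a ord0.
Proof. by rewrite mxE mxtens_indexK. Qed.

Lemma tensmx11 : tensmx (1%:M : 'M[R]_N) (1%:M : 'M[R]_d) = 1%:M.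
Proof.
apply/matrixP => k l; case: (mxtens_indexP k) => i a.
case: (mxtens_indexP l) => j b; rewrite tensmxE !mxE -natrM mulnb.
by rewrite (can_eq (@mxtens_indexK N d)) xpair_eqE.
Qed.

Lemma tensmx1_stack (A : 'M[R]_N) (x : 'I_N -> 'cV[R]_d) :
  tensmx A (1%:M : 'M[R]_d) *m stack x = stack (fun i => \sum_j A i j *: x j).
Proof.
apply/matrixP => l c; rewrite ord1 {c}.
case: (mxtens_indexP l) => i a.
rewrite stackE mxE summxE (reindex (@mxtens_index N d)) /=; last first.
  by exists (@mxtens_unindex N d) => k _; rewrite (mxtens_indexK, mxtens_unindexK).
transitivity (\sum_j \sum_b A i j * (a == b)%:R * x j b ord0).
  rewrite pair_bigA; apply: eq_bigr => -[j b] _ /=.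
  by rewrite tensmxE stackE mxE.
apply: eq_bigr => j _; rewrite mxE (bigD1 a) //= eqxx mulr1 big1 ?addr0 // => b ba.
by rewrite eq_sym (negPf ba) mulr0 mul0r.
Qed.

Lemma stackK (q : 'cV[R]_(N * d)) :
  q = stack (fun i => \col_a q (mxtens_index (i, a)) ord0).
Proof.
apply/matrixP => l c; rewrite ord1 {c}; case: (mxtens_indexP l) => i a.
by rewrite !mxE mxtens_indexK.
Qed.

Lemma dot_stack (x y : 'I_N -> 'cV[R]_d) :
  dot (stack x) (stack y) = \sum_i dot (x i) (y i).
Proof.
rewrite /dot (reindex (@mxtens_index N d)) /=; last first.
  by exists (@mxtens_unindex N d) => k _; rewrite (mxtens_indexK, mxtens_unindexK).
by rewrite pair_bigA; apply: eq_bigr => -[j b] _; rewrite !stackE.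
Qed.

Lemma stackD (x y : 'I_N -> 'cV[R]_d) : stack x + stack y = stack (fun i => x i + y i).
Proof. by apply/matrixP => l c; rewrite !mxE. Qed.

Lemma stackB (x y : 'I_N -> 'cV[R]_d) : stack x - stack y = stack (fun i => x i - y i).
Proof. by apply/matrixP => l c; rewrite !mxE. Qed.

Lemma stackZ a (x : 'I_N -> 'cV[R]_d) : a *: stack x = stack (fun i => a *: x i).
Proof. by apply/matrixP => l c; rewrite !mxE. Qed.

(** Tensoring with the identity acts on each coordinate slice separately, hence
    preserves operator bounds. *)
Lemma tensmx1_dot_le (A : 'M[R]_N) (c : R) (q : 'cV[R]_(N * d)) :
  (forall v, dot (A *m v) (A *m v) <= c * dot v v) ->
  dot (tensmx A (1%:M : 'M[R]_d) *m q) (tensmx A (1%:M : 'M[R]_d) *m q) <= c * dot q q.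
Proof.
move=> Ac; have [x ->] : exists x, q = stack x by eexists; exact: stackK.
rewrite tensmx1_stack !dot_stack.
rewrite /dot exchange_big [X in _ * X]exchange_big mulr_sumr /=.
apply: ler_sum => a _; have := Ac (\col_i x i a ord0).
rewrite /dot; congr (_ <= _).
  by apply: eq_bigr => i _; rewrite mxE summxE; congr (_ * _);
    apply: eq_bigr => j _; rewrite !mxE.
by congr (_ * _); apply: eq_bigr => i _; rewrite !mxE.
Qed.

Lemma trans_prod_tens (A : nat -> 'M[R]_N) k m :
  trans_prod (fun k => tensmx (A k) (1%:M : 'M[R]_d)) k m =
  tensmx (trans_prod A k m) (1%:M : 'M[R]_d).
Proof.
elim: m => [|m IH] /=; last by rewrite IH tensmx_mul mul1mx.
exact: esym tensmx11.
Qed.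

Lemma tensmx1B (A B : 'M[R]_N) : tensmx (A - B) (1%:M : 'M[R]_d) =
  tensmx A 1%:M - tensmx B 1%:M.
Proof. by apply/matrixP => i j; rewrite !mxE mulrBl. Qed.

End Kronecker.

(** * Doubly stochastic mixing and the Lyapunov equation *)

Section Network.
Context {R : realType} {N : nat}.
Variables (W : nat -> 'M[R]_N) (tau : nat) (lam : R).
Hypothesis N0 : (0 < N)%N.
Hypothesis hW : network_assumption W tau lam.

Let Ni : (N%:R : R) != 0.
Proof. by rewrite pnatr_eq0 -lt0n. Qed.

Lemma row_sum k i : \sum_j W k i j = 1.
Proof.
have /matrixP /(_ i ord0) := network_row hW k; rewrite !mxE => <-.
by apply: eq_bigr => j _; rewrite mxE mulr1.
Qed.

Lemma col_sum k j : \sum_i W k i j = 1.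
Proof.
have /matrixP /(_ ord0 j) := network_col hW k; rewrite !mxE => <-.
by apply: eq_bigr => i _; rewrite mxE mul1r.
Qed.

(** Jensen's inequality in each row, then summation over the columns. *)
Lemma mixing_nonexpansive k v : dot (W k *m v) (W k *m v) <= dot v v.
Proof.
have rowP i : (W k *m v) i ord0 ^+ 2 <= \sum_j W k i j * v j ord0 ^+ 2.
  set m := (W k *m v) i ord0.
  have mE : m = \sum_j W k i j * v j ord0 by rewrite /m mxE.
  have : 0 <= \sum_j W k i j * (v j ord0 - m) ^+ 2.
    by apply: sumr_ge0 => j _; rewrite mulr_ge0 ?sqr_ge0 ?(network_nonneg hW).
  rewrite (eq_bigr (fun j => W k i j * v j ord0 ^+ 2
     - 2 * m * (W k i j * v j ord0) + m ^+ 2 * W k i j)); last by move=> j _; ring.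
  rewrite !big_split /= sumrN -!mulr_sumr -mE row_sum => h.
  by rewrite -subr_ge0 (_ : _ - _ = \sum_j W k i j * v j ord0 ^+ 2 - 2 * m * m + m ^+ 2 * 1) //; ring.
rewrite /dot; under eq_bigr do rewrite -expr2.
apply: (le_trans (ler_sum _ (fun i _ => rowP i))).
rewrite exchange_big /= le_eqVlt; apply/orP; left; apply/eqP.
by apply: eq_bigr => j _; rewrite -mulr_suml col_sum mul1r expr2.
Qed.

Lemma mixing_avg k : W k *m avg_mx N = avg_mx N.
Proof.
apply/matrixP => i j; rewrite !mxE.
by under eq_bigr do rewrite mxE; rewrite -mulr_suml row_sum mul1r.
Qed.

Lemma avg_mx_idem : avg_mx N *m avg_mx N = avg_mx N :> 'M[R]_N.
Proof.
apply/matrixP => i j; rewrite !mxE; under eq_bigr do rewrite !mxE.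
by rewrite sumr_const card_ord -[_ *+ N]mulr_natl mulrA divff // mul1r.
Qed.

Lemma avg_mx_sym : (avg_mx N)^T = avg_mx N :> 'M[R]_N.
Proof. by apply/matrixP => i j; rewrite !mxE. Qed.

Lemma Wtilde_centered k : Wtilde W k = W k *m (1%:M - avg_mx N).
Proof. by rewrite mulmxBr mulmx1 mixing_avg. Qed.

(** The centering matrix is an orthogonal projection. *)
Lemma centering_nonexpansive (v : 'cV[R]_N) :
  dot ((1%:M - avg_mx N) *m v) ((1%:M - avg_mx N) *m v) <= dot v v.
Proof.
rewrite mulmxBl mul1mx; set p := avg_mx N *m v.
have pp : dot p p = dot v p.
  by rewrite {1}/p dot_mulmx avg_mx_sym /p mulmxA avg_mx_idem.
have := dot_ge0 p; move: p pp => p pp p0.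
rewrite dotBl !dotBr (dotC p v) -pp; lra.
Qed.

Lemma Wtilde_nonexpansive k v : dot (Wtilde W k *m v) (Wtilde W k *m v) <= dot v v.
Proof.
rewrite Wtilde_centered -mulmxA.
exact: le_trans (mixing_nonexpansive _ _) (centering_nonexpansive _).
Qed.

Lemma trans_prod_nonexpansive k m v :
  dot (trans_prod (Wtilde W) k m *m v) (trans_prod (Wtilde W) k m *m v) <= dot v v.
Proof.
elim: m => [|m IH] /=; first by rewrite mul1mx.
by rewrite -mulmxA; apply: le_trans (Wtilde_nonexpansive _ _) IH.
Qed.

Lemma trans_prod_contract k v :
  dot (trans_prod (Wtilde W) k tau *m v) (trans_prod (Wtilde W) k tau *m v)
  <= lam ^+ 2 * dot v v.
Proof.
have /andP[l0 l1] := network_lam hW.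
set A := trans_prod _ _ _.
have [v0|vn] := eqVneq v 0.
  by rewrite v0 mulmx0 /dot !big1 ?mulr0 // => i _; rewrite mxE mul0r.
have vv : 0 < dot v v.
  by rewrite lt_neqAle dot_ge0 andbT eq_sym; apply/eqP => e; move/eqP: vn; apply;
    apply: dot_eq0; rewrite e.
have ev : 0 < enorm v.
  rewrite lt_neqAle enorm_ge0 andbT; apply/eqP => e; move: vv.
  by rewrite -enorm_sq -e expr0n ltxx.
have sqc a u : 0 <= a -> enorm (a *: u) = a * enorm u :> R.
  move=> a0; apply/eqP; rewrite -(@eqrXn2 _ 2) ?enorm_ge0 ?mulr_ge0 ?enorm_ge0 //.
  by rewrite exprMn !enorm_sq dotZl dotZr mulrA expr2.
have : enorm (A *m ((enorm v)^-1 *: v)) <= lam.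
  apply: le_trans (network_contract hW k); apply: ub_le_sup.
    exists 1 => _ [u /= u1 <-]; rewrite -(@ler_sqr _ _ 1) ?nnegrE ?enorm_ge0 //.
    rewrite enorm_sq; apply: le_trans (trans_prod_nonexpansive _ _ _) _.
    by rewrite -enorm_sq ler_sqr ?nnegrE ?enorm_ge0.
  exists ((enorm v)^-1 *: v) => //=.
  by rewrite sqc ?invr_ge0 ?enorm_ge0 // mulVf // gt_eqF.
rewrite -scalemxAr sqc ?invr_ge0 ?enorm_ge0 // ler_pdivrMl // => h.
by rewrite -!enorm_sq -exprMn ler_sqr ?nnegrE ?enorm_ge0 ?mulr_ge0 ?enorm_ge0 // mulrC.
Qed.

Section Lifted.
Variable d : nat.
Implicit Types q : 'cV[R]_(N * d).

Let Psi k m := trans_prod (bWtilde d W) k m.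
Let delta := delta_of tau lam.

Lemma bWtilde_nonexpansive k q : dot (bWtilde d W k *m q) (bWtilde d W k *m q) <= dot q q.
Proof.
rewrite -[leRHS]mul1r; apply: tensmx1_dot_le => v; rewrite mul1r.
exact: Wtilde_nonexpansive.
Qed.

Let Psi_nonexpansive k m q : dot (Psi k m *m q) (Psi k m *m q) <= dot q q.
Proof.
rewrite /Psi trans_prod_tens -[leRHS]mul1r; apply: tensmx1_dot_le => v.
by rewrite mul1r; exact: trans_prod_nonexpansive.
Qed.

Let Psi_contract k q :
  dot (Psi k tau *m q) (Psi k tau *m q) <= lam ^+ 2 * dot q q.
Proof.
rewrite /Psi trans_prod_tens; apply: tensmx1_dot_le => v.
exact: trans_prod_contract.
Qed.

Let energy k q n := \sum_(r < n) dot (Psi k r *m q) (Psi k r *m q).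

Let energy_nd k q : nondecreasing_seq (energy k q).
Proof.
by apply/nondecreasing_seqP => n; rewrite /energy big_ord_recr /= lerDl dot_ge0.
Qed.

Let tau0 : (0 : R) < tau%:R.
Proof. by rewrite ltr0n; exact: network_tau hW. Qed.

Let lam2 : lam ^+ 2 < 1.
Proof. by have /andP[l0 l1] := network_lam hW; rewrite exprn_ilt1. Qed.

Lemma delta_gt0 : 0 < delta.
Proof. by rewrite divr_gt0 // subr_gt0. Qed.

Lemma delta_le1 : delta <= 1.
Proof.
rewrite /delta /delta_of ler_pdivrMr // mul1r.
have : (1 : R) <= tau%:R by rewrite ler1n; exact: network_tau hW.
have := sqr_ge0 lam; lra.
Qed.

(** Delaying the sum by [tau] steps costs at most [tau] terms and gains the
    factor [lam ^+ 2], so the partial sums are bounded by a geometric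
    fixed-point argument. *)
Let energy_le k q n : delta * energy k q n <= dot q q.
Proof.
have shift : energy k q (tau + n) <= tau%:R * dot q q + lam ^+ 2 * energy k q n.
  rewrite /energy big_split_ord /= lerD //.
    have -> : tau%:R * dot q q = \sum_(i < tau) dot q q.
      by rewrite sumr_const card_ord mulr_natl.
    by apply: ler_sum => i _; exact: Psi_nonexpansive.
  rewrite mulr_sumr; apply: ler_sum => i _.
  rewrite /Psi addnC trans_prodD -!mulmxA.
  exact: Psi_contract.
have mono : energy k q n <= energy k q (tau + n) by apply: energy_nd; rewrite leq_addl.
rewrite /delta /delta_of mulrAC ler_pdivrMr //; lra.
Qed.

Let Sn k n := series (fun r => (Psi k r)^T *m Psi k r) n.

Let wnorm2_Sn k q n : wnorm2 (Sn k n) q = energy k q n.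
Proof.
rewrite /Sn /series /= /energy big_mkord wnorm2E mulmx_suml dotC dot_suml.
by apply: eq_bigr => i _; rewrite dotC -wnorm2E wnorm2_gram.
Qed.

Let energy_cvg k q : (fun n => delta * energy k q n) @ \oo -->
  wnorm2 (Rmx d W tau lam k) q.
Proof.
have -> : wnorm2 (Rmx d W tau lam k) q = delta * wnorm2 (limn (Sn k)) q.
  by rewrite /Rmx !wnorm2E -scalemxAl dotZr.
apply: cvgMr.
have -> : energy k q = (fun n => wnorm2 (Sn k n) q).
  by apply/funext => n; rewrite wnorm2_Sn.
apply: cvg_wnorm2_lim => [n|p].
  rewrite /Sn /series /= raddf_sum; apply: eq_bigr => i _.
  by rewrite /= trmx_mul trmxK.
apply: (@nondecreasing_is_cvgn _ (fun n => wnorm2 (Sn k n) p)).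
  by move=> a b ab; rewrite !wnorm2_Sn; exact: energy_nd.
exists (delta^-1 * dot p p) => _ [n _ <-]; rewrite wnorm2_Sn.
by rewrite ler_pdivlMl ?delta_gt0 //; exact: energy_le.
Qed.

Lemma Rmx_ge0 k q : 0 <= wnorm2 (Rmx d W tau lam k) q.
Proof.
have c := @energy_cvg k q; rewrite -(cvg_lim _ c) //.
apply: limr_ge; first by apply/cvg_ex; eexists; exact: c.
near=> n; rewrite mulr_ge0 // ?(ltW delta_gt0) // sumr_ge0 // => i _.
exact: dot_ge0.
Unshelve. all: by end_near.
Qed.

Lemma Rmx_le k q : wnorm2 (Rmx d W tau lam k) q <= dot q q.
Proof.
have c := @energy_cvg k q; rewrite -(cvg_lim _ c) //.
apply: limr_le; first by apply/cvg_ex; eexists; exact: c.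
by near=> n; exact: energy_le.
Unshelve. all: by end_near.
Qed.

(** The Lyapunov equation satisfied by [Rmx]: split off the first term of the
    series. *)
Lemma Rmx_lyapunov k q : wnorm2 (Rmx d W tau lam k) q =
  delta * dot q q + wnorm2 (Rmx d W tau lam k.+1) (bWtilde d W k *m q).
Proof.
have c1 := @energy_cvg k q; have c2 := @energy_cvg k.+1 (bWtilde d W k *m q).
have c3 : (fun n => delta * energy k q n.+1) @ \oo --> wnorm2 (Rmx d W tau lam k) q.
  by have := c1; rewrite -(cvg_shiftS (fun n => delta * energy k q n)).
have E : (fun n => delta * energy k q n.+1) =
  (fun n => delta * dot q q + delta * energy k.+1 (bWtilde d W k *m q) n).
  apply/funext => n; rewrite -mulrDr /energy big_ord_recl; congr (_ * (_ + _)).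
    by rewrite /Psi /= mul1mx.
  by apply: eq_bigr => i _; rewrite /Psi lift0 trans_prodSr -mulmxA.
rewrite E in c3; apply: (cvg_unique _ c3) => //.
by apply: cvgD => //; exact: cvg_cst.
Qed.

End Lifted.
End Network.

(** * Drift of the consensus and tracking errors *)

Section LyapunovDrift.
Context {R : realType} {N d : nat}.
Variables (W : nat -> 'M[R]_N) (tau : nat) (lam alpha : R).
Hypothesis N0 : (0 < N)%N.
Hypothesis hW : network_assumption W tau lam.

Local Notation delta := (delta_of tau lam).
Local Notation eta := (eta_of tau lam).
Local Notation Q := (Q_of tau lam).
Local Notation Rk := (Rmx d W tau lam).
Local Notation Wt := (bWtilde d W).

(** The lift of [I - W k], through which the sampled gradients enter the
    tracking error. *)
Definition bWcompl k : 'M[R]_(N * d) := tensmx (1%:M - W k) (1%:M : 'M[R]_d).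

Lemma bWcompl_le k q : dot (bWcompl k *m q) (bWcompl k *m q) <= 4 * dot q q.
Proof.
apply: tensmx1_dot_le => v; rewrite mulmxBl mul1mx.
apply: le_trans (dotD_le2 _ _) _; rewrite dotNl dotNr opprK.
have := mixing_nonexpansive hW k v; lra.
Qed.

Lemma eta_gt0 : 0 < eta.
Proof.
have /andP[l0 l1] := network_lam hW.
by rewrite divr_gt0 ?subr_gt0 // mulr_gt0 // ltr0n (network_tau hW).
Qed.

Lemma eta_le : eta <= delta / 2.
Proof.
have /andP[l0 l1] := network_lam hW.
have t0 : (0 : R) < tau%:R by rewrite ltr0n (network_tau hW).
rewrite /eta_of /delta_of invfM mulrA mulrAC ler_pM2r // ler_pM2r ?invr_gt0 //.
have : 0 <= lam * (1 - lam) by rewrite mulr_ge0 // subr_ge0 ltW.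
lra.
Qed.

Lemma Q_ge0 : 0 <= Q.
Proof. by rewrite addr_ge0 // divr_ge0 // sqr_ge0. Qed.

Let p k (q : 'cV[R]_(N * d)) := wnorm2 (Rk k.+1) (Wt k *m q).

Let p_le k q : p k q <= dot q q.
Proof.
exact: le_trans (Rmx_le N0 hW _ _) (bWtilde_nonexpansive N0 hW _ _).
Qed.

(** Young's inequality with parameter [delta / 9] separates the gradient
    increments, and with [delta / 2] it separates the two error components; the
    resulting inflation of the error terms is smaller than the decrement
    [delta * dot q q] of the Lyapunov equation. *)
Lemma lyapunov_drift k (x z D : 'cV[R]_(N * d)) :
  wnorm2 (Rk k.+1) (Wt k *m (x - eta *: z - alpha *: D)) +
  2 * wnorm2 (Rk k.+1) (Wt k *m z - (alpha / eta) *: (bWcompl k *m D)) <=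
  wnorm2 (Rk k) x + 2 * wnorm2 (Rk k) z - delta / 4 * (dot x x + 2 * dot z z)
  + 10 * alpha ^+ 2 * Q / delta * dot D D.
Proof.
have R0 := @Rmx_ge0 _ _ _ _ _ N0 hW d k.+1.
have dl0 := delta_gt0 hW; have dl1 := delta_le1 hW.
have e0 := eta_gt0; have e1 := eta_le.
have th0 : 0 < delta / 9 by rewrite divr_gt0.
have rh0 : 0 < delta / 2 by rewrite divr_gt0.
have S1 := wnorm2_young (Wt k *m (x - eta *: z)) (Wt k *m (- (alpha *: D))) th0 R0.
have S2 := wnorm2_young (Wt k *m x) (Wt k *m (- (eta *: z))) rh0 R0.
have S3 := wnorm2_young (Wt k *m z) (- ((alpha / eta) *: (bWcompl k *m D))) th0 R0.
rewrite -!mulmxDr in S1 S2; move: S1 S2 S3.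
rewrite !mulmxN !wnorm2N -!scalemxAr !wnorm2Z -!/(p k _).
have DD : wnorm2 (Rk k.+1) (bWcompl k *m D) <= 4 * dot D D.
  by apply: le_trans (Rmx_le N0 hW _ _) _; exact: bWcompl_le.
rewrite (Rmx_lyapunov N0 hW k x) (Rmx_lyapunov N0 hW k z) -!/(p k _).
have D0 := dot_ge0 D.
move: (p_le k x) (p_le k z) (p_le k D) (R0 (Wt k *m x)) (R0 (Wt k *m z)) (R0 (Wt k *m D)) DD.
rewrite -!/(p k _) /Q_of (invf_div delta 9) (invf_div delta 2).
move: (p k (x - eta *: z - alpha *: D)) (p k (x - eta *: z)) => u1 pxz.
move: (wnorm2 _ (bWcompl k *m D)) (wnorm2 _ (Wt k *m z - _)) => wD u2.
move: (dot x x) (dot z z) (dot D D) (p k x) (p k z) (p k D) D0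
  => X Z DD px pz pD D0.
move: (delta) (eta) dl0 dl1 e0 e1 => dl e dl0 dl1 e0 e1 hx hz hD px0 pz0 pD0 hwD S1 S2 S3.
have ne : e != 0 by rewrite gt_eqF.
have nd : dl != 0 by rewrite gt_eqF.
have i1 : 1 <= dl^-1 by rewrite invf_ge1.
(* the gradient increments: [1 + 9 / delta <= 10 / delta] *)
have gradient : (1 + 9 / dl) * (alpha ^+ 2 * pD) + 2 * ((1 + 9 / dl) * ((alpha / e) ^+ 2 * wD))
  <= 10 * alpha ^+ 2 * (1 + 8 / e ^+ 2) / dl * DD.
  have -> : 10 * alpha ^+ 2 * (1 + 8 / e ^+ 2) / dl * DD =
    (10 / dl) * (alpha ^+ 2 * DD) + 2 * ((10 / dl) * ((alpha / e) ^+ 2 * (4 * DD))).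
    by field; rewrite ne nd.
  have c0 : 0 <= 1 + 9 / dl by rewrite addr_ge0 // divr_ge0 // ltW.
  have c1 : 1 + 9 / dl <= 10 / dl by lra.
  apply: lerD; last rewrite ler_pM2l //.
    apply: ler_pM => //; first by rewrite mulr_ge0 ?sqr_ge0.
    by rewrite ler_wpM2l ?sqr_ge0.
  apply: (@le_trans _ _ ((1 + 9 / dl) * ((alpha / e) ^+ 2 * (4 * DD)))).
    by rewrite ler_wpM2l // ler_wpM2l ?sqr_ge0.
  by rewrite ler_wpM2r // mulr_ge0 ?sqr_ge0 // mulr_ge0.
(* the coupling of the errors: [eta <= delta / 2], and [delta <= 1] *)
have coupling : (1 + 2 / dl) * (e ^+ 2 * pz) <= 3 / 4 * dl * pz.
  rewrite mulrA ler_wpM2r //.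
  have : e ^+ 2 <= (dl / 2) ^+ 2 by rewrite ler_sqr ?nnegrE ?(ltW e0) // ltW // divr_gt0.
  move=> h; apply: (@le_trans _ _ ((1 + 2 / dl) * (dl / 2) ^+ 2)).
    by rewrite ler_wpM2l // addr_ge0 // divr_ge0 // ltW.
  rewrite (_ : (1 + _) * _ = dl ^+ 2 / 4 + dl / 2); last by field.
  have : 0 <= dl * (1 - dl) by rewrite mulr_ge0 ?subr_ge0 // ltW.
  lra.
have xx : (1 + dl / 9) * ((1 + dl / 2) * px) <= px + dl * X - dl / 4 * X.
  have a1 : 0 <= dl * (1 - dl) * px by rewrite !mulr_ge0 ?subr_ge0 // ltW.
  have a2 : 0 <= dl * (X - px) by rewrite mulr_ge0 ?subr_ge0 // ltW.
  have a3 : 0 <= dl * px by rewrite mulr_ge0 // ltW.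
  lra.
have zz : (1 + dl / 9) * (3 / 4 * dl * pz) + 2 * ((1 + dl / 9) * pz) <=
   2 * pz + 2 * dl * Z - dl / 2 * Z.
  have a1 : 0 <= dl * (1 - dl) * pz by rewrite !mulr_ge0 ?subr_ge0 // ltW.
  have a2 : 0 <= dl * (Z - pz) by rewrite mulr_ge0 ?subr_ge0 // ltW.
  have a3 : 0 <= dl * pz by rewrite mulr_ge0 // ltW.
  lra.
have pxz_le : (1 + dl / 9) * pxz <= (1 + dl / 9) * ((1 + dl / 2) * px)
   + (1 + dl / 9) * (3 / 4 * dl * pz).
  rewrite -mulrDr ler_wpM2l //; first by rewrite addr_ge0 // divr_ge0 // ltW.
  by apply: le_trans S2 _; rewrite lerD2l.
lra.
Qed.

(** Centred noise is only added to the energy: [1 + 2 * 4 / eta ^+ 2] is [Q]. *)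
Lemma lyapunov_noise k (s : 'cV[R]_(N * d)) :
  wnorm2 (Rk k.+1) (alpha *: (Wt k *m s)) +
  2 * wnorm2 (Rk k.+1) ((alpha / eta) *: (bWcompl k *m s)) <=
  alpha ^+ 2 * Q * dot s s.
Proof.
have ne : eta != 0 by rewrite gt_eqF // eta_gt0.
rewrite !wnorm2Z.
have h1 : alpha ^+ 2 * wnorm2 (Rk k.+1) (Wt k *m s) <= alpha ^+ 2 * dot s s.
  by rewrite ler_wpM2l ?sqr_ge0 //; exact: p_le.
have h2 : (alpha / eta) ^+ 2 * wnorm2 (Rk k.+1) (bWcompl k *m s)
  <= (alpha / eta) ^+ 2 * (4 * dot s s).
  rewrite ler_wpM2l ?sqr_ge0 //.
  by apply: le_trans (Rmx_le N0 hW _ _) _; exact: bWcompl_le.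
have -> : alpha ^+ 2 * Q * dot s s =
  alpha ^+ 2 * dot s s + 2 * ((alpha / eta) ^+ 2 * (4 * dot s s)).
  by rewrite /Q_of; field.
lra.
Qed.

End LyapunovDrift.

(** * Real expectations and sub-sigma-algebras *)

Section Integrals.
Import HBNNSimple.
Context {dT : measure_display} {T : measurableType dT} {R : realType}.
Variable P : probability T R.
Implicit Types (f g U : T -> R) (A : set T).

Local Notation intg f := (P.-integrable setT (EFin \o f)).
Local Notation Ex f := (Rintegral P setT f).

Lemma intg_measurable f : intg f -> measurable_fun setT f.
Proof. by move=> /measurable_int/measurable_EFinP. Qed.

Lemma intg_le f g : measurable_fun setT f -> intg g ->
  (forall w, `|f w| <= `|g w|) -> intg f.
Proof.
move=> mf ig fg; apply: le_integrable ig => //; first exact/measurable_EFinP.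
by move=> w _; rewrite /= lee_fin.
Qed.

Lemma intgD f g : intg f -> intg g -> intg (fun w => f w + g w).
Proof. by move=> i1 i2; have := integrableD measurableT i1 i2. Qed.

Lemma intgB f g : intg f -> intg g -> intg (fun w => f w - g w).
Proof. by move=> i1 i2; have := integrableB measurableT i1 i2. Qed.

Lemma intgZ c f : intg f -> intg (fun w => c * f w).
Proof. by move=> i; have := integrableZl measurableT c i. Qed.

Lemma intg_cst c : intg (fun=> c).
Proof. exact: finite_measure_integrable_cst. Qed.

Lemma intg_sum (I : Type) (s : seq I) (f : I -> T -> R) :
  (forall i, intg (f i)) -> intg (fun w => \sum_(i <- s) f i w).
Proof.
move=> fi; elim: s => [|i s IH].
  by rewrite (_ : (fun w => _) = fun=> 0); [exact: intg_cst|apply/funext => w; rewrite big_nil].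
rewrite (_ : (fun w => _) = fun w => f i w + \sum_(j <- s) f j w).
  exact: intgD.
by apply/funext => w; rewrite big_cons.
Qed.

Lemma ExD f g : intg f -> intg g -> Ex (fun w => f w + g w) = Ex f + Ex g.
Proof. by move=> i1 i2; rewrite RintegralD. Qed.

Lemma ExB f g : intg f -> intg g -> Ex (fun w => f w - g w) = Ex f - Ex g.
Proof. by move=> i1 i2; rewrite RintegralB. Qed.

Lemma ExZ c f : intg f -> Ex (fun w => c * f w) = c * Ex f.
Proof. by move=> i; rewrite RintegralZl. Qed.

Lemma Ex_cst c : Ex (fun=> c) = c.
Proof.
rewrite Rintegral_cst //; have := probability_setT P => /(congr1 (@fine R)) E.
by rewrite [fine _]E mulr1.
Qed.

Lemma Ex_sum (I : Type) (s : seq I) (f : I -> T -> R) :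
  (forall i, intg (f i)) ->
  Ex (fun w => \sum_(i <- s) f i w) = \sum_(i <- s) Ex (f i).
Proof.
move=> fi; elim: s => [|i s IH].
  rewrite big_nil (_ : (fun w => _) = fun=> 0) ?Ex_cst//.
  by apply/funext => w; rewrite big_nil.
rewrite big_cons -IH -ExD //; last exact: intg_sum.
by congr (Rintegral _ _ _); apply/funext => w; rewrite big_cons.
Qed.

Lemma Ex_le f g : intg f -> intg g -> (forall w, f w <= g w) -> Ex f <= Ex g.
Proof. by move=> i1 i2 fg; apply: le_Rintegral. Qed.

Lemma indicM A f : (fun w => \1_A w * f w) = f \_ A.
Proof.
apply/funext => w; rewrite /patch indicE.
by case: ifP => _; rewrite ?mul1r ?mul0r.
Qed.

Lemma intg_indic A f : measurable A -> intg f -> intg (fun w => \1_A w * f w).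
Proof.
move=> mA i; apply: (intg_le _ i).
  by apply: measurable_funM; [exact: measurable_indic | exact: intg_measurable].
move=> w; rewrite normrM indicE; case: (_ \in _); first by rewrite normr1 mul1r.
by rewrite normr0 mul0r.
Qed.

Lemma Ex_indic A f : Ex (fun w => \1_A w * f w) = \int[P]_(w in A) f w.
Proof. by rewrite indicM [RHS]Rintegral_mkcond. Qed.

Lemma integral_EFin A f : measurable A -> intg f ->
  (\int[P]_(w in A) (f w)%:E)%E = (Ex (fun w => \1_A w * f w))%:E.
Proof.
move=> mA i; rewrite Ex_indic /Rintegral fineK //; apply: integrable_fin_num => //.
exact: integrableS i.
Qed.

Lemma ExE f : intg f -> (\int[P]_w (f w)%:E)%E = (Ex f)%:E.
Proof. by move=> i; rewrite /Rintegral fineK //; exact: integrable_fin_num. Qed.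

(** The sets over which an integrable function has zero integral form a Dynkin
    system. *)
Lemma pi_system_Ex_eq0 (G : set (set T)) U : setI_closed G ->
  G `<=` measurable -> G setT -> intg U ->
  (forall A, G A -> Ex (fun w => \1_A w * U w) = 0) ->
  forall A, <<s G >> A -> Ex (fun w => \1_A w * U w) = 0.
Proof.
move=> GI Gm GT iU G0.
pose H := [set A | measurable A /\ Ex (fun w => \1_A w * U w) = 0].
suff : <<s G >> `<=` H by move=> GH A /GH [].
apply: lambda_system_subset => //; last first.
  by move=> A GA; split; [exact: Gm | exact: G0].
apply/dynkin_lambda_system; split => /=.
- by split=> //; exact: G0.
- move=> A [mA A0]; split; first exact: measurableC.
  have <- : Ex (fun w => \1_setT w * U w) - Ex (fun w => \1_A w * U w) = 0.
    by rewrite A0 subr0; exact: G0.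
  rewrite -ExB; try exact: intg_indic.
  by congr (Rintegral _ _ _); apply/funext => w; rewrite !indicE in_setC in_setT;
    case: (_ \in _); rewrite ?mul0r ?mul1r ?subrr ?subr0.
- move=> F tF FH; split; first by apply: bigcupT_measurable => n; have [] := FH n.
  have mF n : measurable (F n) by have [] := FH n.
  apply: EFin_inj; rewrite -integral_EFin //; last exact: bigcupT_measurable.
  rewrite integral_bigcup //; last first.
    by apply: integrableS iU => //; exact: bigcupT_measurable.
  by apply: eseries0 => n _ _; rewrite integral_EFin //; have [_ ->] := FH n.
Qed.

(** Linearity gives simple functions; dominated convergence gives the positive
    and the negative part of [Z]. *)
Lemma Ex_mul_eq0 (S : set (set T)) (U : T -> R) (Z : g_sigma_algebraType S -> R) :
  S `<=` measurable -> measurable_fun setT Z ->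
  intg U -> intg (fun w => Z w * U w) ->
  (forall A, <<s S >> A -> Ex (fun w => \1_A w * U w) = 0) ->
  Ex (fun w => Z w * U w) = 0.
Proof.
move=> Sm mZ iU iZU S0.
have sm A : <<s S >> A -> measurable A.
  by apply: smallest_sub => //; exact: sigma_algebra_measurable.
have mST (f : g_sigma_algebraType S -> R) : measurable_fun setT f ->
    measurable_fun (setT : set T) (f : T -> R).
  by move=> mf _ B mB; apply: sm; exact: mf.
have simple (h : {nnsfun (g_sigma_algebraType S) >-> R}) :
    intg (fun w => h w * U w) /\ Ex (fun w => h w * U w) = 0.
  have E : (fun w => h w * U w) = (fun w => \sum_(y <- finmap.enum_fset (fset_set (range h)))
      y * (\1_(h @^-1` [set y]) w * U w)).
    apply/funext => w; rewrite {1}fimfunE fsbig_finite//= mulr_suml.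
    by apply: eq_bigr => y _; rewrite mulrA.
  have mh y : <<s S >> (h @^-1` [set y]).
    exact: (measurable_funPTI h (measurable_set1 y)).
  have ih y : intg (fun w => y * (\1_(h @^-1` [set y]) w * U w)).
    by apply/intgZ/intg_indic => //; exact: sm.
  rewrite E; split; first exact: intg_sum.
  rewrite Ex_sum // big1 // => y _; rewrite ExZ ?S0 ?mulr0 //.
  by apply: intg_indic => //; exact: sm.
have nonneg (f : g_sigma_algebraType S -> R) : (forall w, 0 <= f w) ->
    measurable_fun setT f -> intg (fun w => f w * U w) ->
    Ex (fun w => f w * U w) = 0.
  move=> f0 mf ifU.
  have mfE : measurable_fun setT (EFin \o f) by exact/measurable_EFinP.
  pose h := nnsfun_approx measurableT mfE.
  have hf n w : (h n w <= f w)%R.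
    rewrite -lee_fin /h nnsfun_approxE; apply: (@le_approx _ _ _ setT (EFin \o f)) => //.
    by move=> x _; rewrite lee_fin.
  have := @dominated_convergence _ T R P setT measurableT
    (fun n => EFin \o (fun w => h n w * U w))
    (EFin \o (fun w => f w * U w)) (EFin \o (fun w => `|f w * U w|)).
  case.
  - move=> n; apply/measurable_EFinP; apply: measurable_funM.
      by apply: mST; exact: (measurable_funP (h n)).
    exact: intg_measurable.
  - exact: measurable_int ifU.
  - apply: aeW => w _; apply: cvg_EFin.
      by near=> n.
    apply: cvgMl.
    have := @cvg_nnsfun_approx _ _ _ setT measurableT (EFin \o f) mfE
      (fun x _ => f0 x) w Logic.I.
    by move=> /fine_cvgP[_].
  - exact: (integrable_norm ifU).
  - apply: aeW => w n _; rewrite /= lee_fin !normrM ler_wpM2r //.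
    by rewrite !ger0_norm.
  move=> _ _ c.
  have E n : (\int[P]_w (h n w * U w)%:E)%E = 0%E.
    by have [ihU hU0] := simple (h n); rewrite (ExE ihU) hU0.
  have c0 : (fun n => \int[P]_w (h n w * U w)%:E)%E @ \oo --> 0%E.
    by rewrite (_ : (fun n => _) = fun=> 0%E); [exact: cvg_cst | apply/funext].
  by rewrite /Rintegral (cvg_unique _ c c0).
pose Zp w := Num.max (Z w) 0; pose Zn w := Num.max (- Z w) 0.
have mZp : measurable_fun setT (Zp : g_sigma_algebraType S -> R).
  by apply: measurable_maxr => //; exact: measurable_cst.
have mZn : measurable_fun setT (Zn : g_sigma_algebraType S -> R).
  by apply: measurable_maxr; [exact: measurable_funN | exact: measurable_cst].
have iZp : intg (fun w => Zp w * U w).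
  apply: (intg_le _ iZU) => [|w].
    by apply: measurable_funM; [exact: mST | exact: intg_measurable].
  rewrite !normrM ler_wpM2r // /Zp; case: (leP (Z w) 0) => h.
    by rewrite normr0.
  by [].
have iZn : intg (fun w => Zn w * U w).
  apply: (intg_le _ iZU) => [|w].
    by apply: measurable_funM; [exact: mST | exact: intg_measurable].
  rewrite !normrM ler_wpM2r // /Zn; case: (leP (- Z w) 0) => h.
    by rewrite normr0.
  by rewrite normrN.
have -> : (fun w => Z w * U w) = (fun w => Zp w * U w - Zn w * U w).
  apply/funext => w; rewrite -mulrBl /Zp /Zn; congr (_ * _).
  case: (leP (Z w) 0) => h.
    by rewrite max_l ?oppr_ge0 // sub0r opprK.
  by rewrite max_r ?oppr_le0 ?ltW // subr0.
rewrite ExB // !nonneg ?subrr //.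
  by move=> w; rewrite le_max lexx orbT.
by move=> w; rewrite le_max lexx orbT.
Unshelve. all: by end_near.
Qed.

End Integrals.

(** * Conditional expectation *)

Section CondExp.
Context {dT : measure_display} {T : measurableType dT} {R : realType}.
Variables (P : probability T R) (G : set (set T)).
Hypotheses (Gs : sigma_algebra setT G) (Gm : G `<=` measurable).
Implicit Types (X Y f g : T -> R).

Local Notation intg f := (P.-integrable setT (EFin \o f)).
Local Notation Ex f := (Rintegral P setT f).
Local Notation GT := (g_sigma_algebraType G).

Lemma measurable_wrtP dU (U : measurableType dU) (X : T -> U) :
  measurable_wrt G X <-> measurable_fun setT (X : GT -> U).
Proof.
split=> [mX _ B mB|mX A [B mB <-]].
  by apply: sub_sigma_algebra; apply: mX; exists B.
by rewrite -(sigma_algebra_id Gs); exact: mX.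
Qed.

Lemma measurable_fun_sub dU (U : measurableType dU) (X : GT -> U) :
  measurable_fun setT X -> measurable_fun (setT : set T) (X : T -> U).
Proof.
move=> mX _ B mB; have := mX measurableT B mB.
by rewrite /measurable /= (sigma_algebra_id Gs) => /Gm.
Qed.

Lemma Ex_ae_eq f g : intg f -> intg g -> {ae P, forall w, f w = g w} ->
  Ex f = Ex g.
Proof.
move=> fi gi fg; congr fine; apply: ae_eq_integral => //.
- exact: measurable_int fi.
- exact: measurable_int gi.
- by apply: filterS fg => w -> _.
Qed.

Lemma Ex_eq0_ae f : intg f -> (forall w, 0 <= f w) -> Ex f <= 0 ->
  {ae P, forall w, f w = 0}.
Proof.
move=> fi f0 Ef.
have E0 : Ex f = 0 by apply/eqP; rewrite eq_le Ef Rintegral_ge0.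
have [+ _] := @ae_eq_integral_abs _ T R P setT measurableT (EFin \o f) (measurable_int _ fi).
move=> H; have : (\int[P]_x `|(EFin \o f) x| = 0)%E.
  rewrite -[RHS]/(0%:E) -E0 -ExE //; apply: eq_integral => w _.
  by rewrite /= ger0_norm.
by move=> /H; apply: filterS => w /(_ Logic.I) [].
Qed.

(** Integrals over events become expectations of products with indicators, for
    which linearity and a.e. equality are at hand; measurability is with respect
    to the sigma-algebra type, so that it composes. *)
Definition cexp X Y := [/\ intg X, intg Y,
  measurable_fun setT (Y : GT -> R) &
  forall A, G A -> Ex (fun w => \1_A w * Y w) = Ex (fun w => \1_A w * X w)].

Lemma is_condexp_cexp X Y : is_condexp P G X Y -> cexp X Y.
Proof.
move=> [iX iY mY XY]; split=> //; first exact/measurable_wrtP.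
by move=> A GA; apply: EFin_inj; rewrite -!integral_EFin ?XY //; exact: Gm.
Qed.

Lemma cexpB X Y X' Y' : cexp X Y -> cexp X' Y' ->
  cexp (fun w => X w - X' w) (fun w => Y w - Y' w).
Proof.
move=> [iX iY mY XY] [iX' iY' mY' XY']; split; [exact: intgB..| |].
  exact: measurable_funB.
move=> A GA; have mA := Gm GA.
have E f g : intg f -> intg g -> Ex (fun w => \1_A w * (f w - g w)) =
    Ex (fun w => \1_A w * f w) - Ex (fun w => \1_A w * g w).
  move=> fi gi; rewrite -ExB; try exact: intg_indic.
  by congr (Rintegral _ _ _); apply/funext => w; rewrite mulrBr.
by rewrite !E // XY // XY'.
Qed.

Lemma cexp_ge0 X Y : cexp X Y -> (forall w, 0 <= X w) ->
  {ae P, forall w, 0 <= Y w}.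
Proof.
move=> [iX iY mY XY] X0; set A := [set w | Y w < 0].
have GA : G A.
  rewrite -(sigma_algebra_id Gs) (_ : A = setT `&` Y @^-1` `]-oo, 0[).
    by apply: mY => //; exact: measurable_itv.
  by rewrite setTI; apply/seteqP; split => w /=; rewrite in_itv.
have : {ae P, forall w, \1_A w * - Y w = 0}.
  have E : (fun w => \1_A w * - Y w) = (fun w => -1 * (\1_A w * Y w)).
    by apply/funext => w; rewrite mulN1r mulrN.
  have iAY : intg (fun w => \1_A w * Y w) by apply: intg_indic => //; exact: Gm.
  apply: Ex_eq0_ae.
  - by rewrite E; exact: intgZ.
  - move=> w; rewrite indicE; case: (boolP (w \in A)).
      by rewrite inE /A /= mul1r oppr_ge0 => /ltW.
    by rewrite mul0r.
  - rewrite E ExZ // mulN1r oppr_le0 XY //; apply: Rintegral_ge0 => w _.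
    by rewrite mulr_ge0 // indicE.
apply: filterS => w; rewrite indicE leNgt; apply: contra_eqN => wA.
by rewrite mem_set // mul1r gt_eqF // oppr_gt0.
Qed.

Lemma cexp_unique X Y Y' : cexp X Y -> cexp X Y' -> {ae P, forall w, Y w = Y' w}.
Proof.
move=> XY XY'.
have h1 : {ae P, forall w, 0 <= Y w - Y' w}.
  by apply: (cexp_ge0 (cexpB XY XY')) => w; rewrite subrr.
have h2 : {ae P, forall w, 0 <= Y' w - Y w}.
  by apply: (cexp_ge0 (cexpB XY' XY)) => w; rewrite subrr.
apply: filterS2 h1 h2 => w; rewrite !subr_ge0 => a b.
by apply/eqP; rewrite eq_le a b.
Qed.

Lemma cexp_cst c : cexp (fun=> c) (fun=> c).
Proof. by split => //; exact: intg_cst. Qed.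

(** Clamping changes a version on a null set only. The bound makes the products
    with integrable functions below integrable. *)
Lemma cexp_unit X Y : cexp X Y -> (forall w, 0 <= X w <= 1) ->
  exists2 Z, cexp X Z & forall w, 0 <= Z w <= 1.
Proof.
move=> XY X01; pose Z w := Num.max 0 (Num.min 1 (Y w)).
have Y0 : {ae P, forall w, 0 <= Y w}.
  by apply: (cexp_ge0 XY) => w; have /andP[] := X01 w.
have Y1 : {ae P, forall w, 0 <= 1 - Y w}.
  apply: (cexp_ge0 (cexpB (cexp_cst 1) XY)) => w; rewrite subr_ge0.
  by have /andP[] := X01 w.
have Z01 w : 0 <= Z w <= 1.
  by rewrite /Z le_max lexx /= ge_max ler01 ge_min lexx.
have YZ : {ae P, forall w, Y w = Z w}.
  apply: filterS2 Y0 Y1 => w y0; rewrite subr_ge0 => y1.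
  by rewrite /Z min_r // max_r.
have [iX iY mY E] := XY.
have mZ : measurable_fun setT (Z : GT -> R).
  by apply: measurable_maxr; [exact: measurable_cst|apply: measurable_minr => //; exact: measurable_cst].
have iZ : intg Z.
  apply: (intg_le _ (intg_cst P 1)); first exact: measurable_fun_sub.
  by move=> w; have /andP[a b] := Z01 w; rewrite !ger0_norm.
exists Z => //; split => // A GA; rewrite -E //.
apply: Ex_ae_eq; [by apply: intg_indic => //; exact: Gm..|].
by apply: filterS YZ => w ->.
Qed.

Lemma cexp_mul X Y (Z : GT -> R) : cexp X Y -> measurable_fun setT Z ->
  intg (fun w => Z w * X w) -> intg (fun w => Z w * Y w) ->
  Ex (fun w => Z w * X w) = Ex (fun w => Z w * Y w).
Proof.
move=> [iX iY mY XY] mZ iZX iZY; apply/eqP; rewrite -subr_eq0 -ExB //.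
have -> : (fun w => Z w * X w - Z w * Y w) = (fun w => Z w * (X w - Y w)).
  by apply/funext => w; rewrite mulrBr.
apply/eqP/(@Ex_mul_eq0 _ _ _ P G) => //; first exact: intgB.
  rewrite (_ : (fun w => _) = (fun w => Z w * X w - Z w * Y w)).
    exact: intgB.
  by apply/funext => w; rewrite mulrBr.
move=> A; rewrite (sigma_algebra_id Gs) => GA; have mA := Gm GA.
have -> : (fun w => \1_A w * (X w - Y w)) =
    (fun w => \1_A w * X w - \1_A w * Y w).
  by apply/funext => w; rewrite mulrBr.
by rewrite ExB ?XY ?subrr //; exact: intg_indic.
Qed.

End CondExp.

(** * Conditional independence implies orthogonality *)

Section Orthogonality.
Context {dT : measure_display} {T : measurableType dT} {R : realType}.
Variables (P : probability T R) (G : set (set T)).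
Hypotheses (Gs : sigma_algebra setT G) (Gm : G `<=` measurable).
Context {I : finType} {dU : I -> measure_display}
  {U : forall i, measurableType (dU i)}.
Variable xi : forall i, {mfun T >-> U i}.
Hypothesis xi_indep : cond_independent P G (fun i => xi i : T -> U i).

Local Notation intg f := (P.-integrable setT (EFin \o f)).
Local Notation Ex f := (Rintegral P setT f).
Local Notation GT := (g_sigma_algebraType G).

(** Measurability for the sigma-algebra spanned by [G] and [xi i] is expressed
    through this generating pi-system, on which the product rule applies. *)
Definition joint_pi (i : I) : set (set T) :=
  [set A | exists H, exists B, [/\ G H, measurable B & A = H `&` xi i @^-1` B]].

Lemma joint_pi_measurable i : joint_pi i `<=` measurable.
Proof.
move=> A [H [B [GH mB ->]]]; apply: measurableI; first exact: Gm.
exact: measurable_funPTI.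
Qed.

Lemma sigma_setT : G setT.
Proof. by have [G0 GC _] := Gs; rewrite -(setD0 setT); exact: GC. Qed.

Lemma sigma_setI A B : G A -> G B -> G (A `&` B).
Proof.
rewrite -(sigma_algebra_id Gs) => GA GB.
exact: (@measurableI _ GT).
Qed.

Lemma joint_pi_setI i : setI_closed (joint_pi i).
Proof.
move=> _ _ [H [B [GH mB ->]]] [H' [B' [GH' mB' ->]]].
exists (H `&` H'), (B `&` B'); split; [exact: sigma_setI|exact: measurableI|].
by rewrite preimage_setI setIACA.
Qed.

Lemma joint_pi_G i A : G A -> joint_pi i A.
Proof. by move=> GA; exists A, setT; split => //; rewrite preimage_setT setIT. Qed.

Lemma joint_measurable_G i d' (V : measurableType d') (Z : T -> V) :
  measurable_wrt G Z ->
  measurable_fun setT (Z : g_sigma_algebraType (joint_pi i) -> V).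
Proof.
move=> mZ _ B mB; apply: sub_sigma_algebra; apply: joint_pi_G.
by apply: mZ; exists B.
Qed.

Lemma joint_measurable_xi i :
  measurable_fun setT (xi i : g_sigma_algebraType (joint_pi i) -> U i).
Proof.
move=> _ B mB; apply: sub_sigma_algebra.
by exists setT, B; split => //; exact: sigma_setT.
Qed.

Let event i (B : set (U i)) : T -> R := \1_(xi i @^-1` B).

Let intg_event i (B : set (U i)) : measurable B -> intg (event B).
Proof.
move=> mB; have := intg_indic (measurable_funPTI (xi i) mB) (intg_cst P 1).
by congr (integrable _ _ _); apply/funext => w; rewrite /= mulr1.
Qed.

Let cexp_event i (B : set (U i)) : measurable B ->
  exists2 q, cexp P G (event B) q & forall w, 0 <= q w <= 1.
Proof.
move=> mB; have mBf l : measurable (dfwith (fun l => setT : set (U l)) i B l).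
  by case: dfwithP.
have [p [pB _]] := xi_indep mBf.
have := is_condexp_cexp Gs Gm (pB i); rewrite dfwithin => c.
by apply: (cexp_unit Gs Gm c) => w; rewrite indicE; case: (_ \in _); rewrite !lexx ler01.
Qed.

(** The family of events is filled up with [setT]; the conditional
    probabilities for these other indices are almost surely 1, and the versions
    supplied by the hypothesis agree a.e. with [p] and [q]. *)
Let event_product i j (Bi : set (U i)) (Bj : set (U j)) p q H : i != j ->
  measurable Bi -> measurable Bj -> cexp P G (event Bi) p ->
  cexp P G (event Bj) q ->
  (forall w, 0 <= p w <= 1) -> (forall w, 0 <= q w <= 1) -> G H ->
  Ex (fun w => \1_H w * (event Bi w * event Bj w)) =
  Ex (fun w => \1_H w * (p w * q w)).
Proof.
move=> ij mBi mBj cp cq p01 q01 GH.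
pose B := dfwith (dfwith (fun l => setT : set (U l)) i Bi) j Bj.
have mB l : measurable (B l).
  by rewrite /B; case: dfwithP => // l' _; case: dfwithP.
have Bj' : B j = Bj by rewrite /B dfwithin.
have Bi' : B i = Bi by rewrite /B dfwithout 1?eq_sym // dfwithin.
have Bl' l : l != i -> l != j -> B l = setT.
  by move=> li lj; rewrite /B !dfwithout // eq_sym.
have [r [rB rP]] := xi_indep mB.
have cr l := is_condexp_cexp Gs Gm (rB l).
have mH := Gm GH.
have E : \1_(\bigcap_(l in [set: I]) (xi l @^-1` B l)) =
    (fun w => event Bi w * event Bj w) :> (T -> R).
  apply/funext => w; rewrite /event !indicE -natrM mulnb; congr (_%:R).
  congr nat_of_bool; apply/idP/andP.
    rewrite inE => h; split; rewrite inE.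
      by rewrite -Bi'; exact: h.
    by rewrite -Bj'; exact: h.
  rewrite !inE => -[hi hj] l _ /=.
  have [->|li] := eqVneq l i; first by rewrite Bi'.
  have [->|lj] := eqVneq l j; first by rewrite Bj'.
  by rewrite Bl'.
have := is_condexp_cexp Gs Gm rP; rewrite E => -[iE iR mR /(_ _ GH) <-].
have ri : {ae P, forall w, r i w = p w}.
  by apply: (cexp_unique Gs Gm (cr i)); rewrite Bi'.
have rj : {ae P, forall w, r j w = q w}.
  by apply: (cexp_unique Gs Gm (cr j)); rewrite Bj'.
have rl : {ae P, forall w, forall l, l != i -> l != j -> r l w = 1}.
  apply: filter_forall => l.
  have [li|li] := eqVneq l i; first by apply: aeW.
  have [lj|lj] := eqVneq l j; first by apply: aeW.
  have := cr l; rewrite (Bl' _ li lj) preimage_setT indicT => crl.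
  by apply: filterS (cexp_unique Gs Gm crl (cexp_cst P G 1)) => w ->.
have [_ _ mp _] := cp; have [_ _ mq _] := cq.
have ipq : intg (fun w => p w * q w).
  apply: (intg_le _ (intg_cst P 1)).
    by apply: measurable_funM; apply: (measurable_fun_sub Gs Gm).
  move=> w; have /andP[a b] := p01 w; have /andP[a' b'] := q01 w.
  by rewrite normr1 ger0_norm ?mulr_ge0 // mulr_ile1.
apply: Ex_ae_eq; [exact: intg_indic..|].
apply: filterS3 ri rj rl => w wi wj wl; congr (_ * _).
rewrite (bigD1 i) //= (bigD1 j) 1?eq_sym //= wi wj big1 ?mulr1 //.
by move=> l /andP[li lj]; exact: wl.
Qed.

(** Conditional independence in its asymmetric form: knowing [xi i] on top of
    [G] does not change the conditional probability of an event of [xi j]. *)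
Let joint_cexp i j (Bj : set (U j)) q : i != j ->
  measurable Bj -> cexp P G (event Bj) q -> (forall w, 0 <= q w <= 1) ->
  forall A, <<s joint_pi i >> A -> Ex (fun w => \1_A w * (event Bj w - q w)) = 0.
Proof.
move=> ij mBj cq q01.
have [_ iq mq _] := cq.
apply: pi_system_Ex_eq0.
- exact: joint_pi_setI.
- exact: joint_pi_measurable.
- exact/joint_pi_G/sigma_setT.
- by apply: intgB => //; exact: intg_event.
move=> _ [H [Bi [GH mBi ->]]]; have mH := Gm GH.
have mXi : measurable (xi i @^-1` Bi) by exact: measurable_funPTI.
have [p cp p01] := cexp_event mBi.
have -> : (fun w => \1_(H `&` xi i @^-1` Bi) w * (event Bj w - q w)) =
    (fun w => \1_H w * (event Bi w * event Bj w) - \1_H w * q w * event Bi w).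
  by apply/funext => w; rewrite /event indicI /=; ring.
have i1 : intg (fun w => event Bi w * event Bj w).
  exact: (intg_indic mXi (intg_event mBj)).
have i2 : intg (fun w => \1_H w * q w * event Bi w).
  rewrite (_ : (fun w => _) = (fun w => \1_H w * (event Bi w * q w))).
    by apply: intg_indic => //; exact: intg_indic.
  by apply/funext => w; ring.
have [_ ip mp _] := cp.
have i3 : intg (fun w => \1_H w * q w * p w).
  apply: (intg_le _ ip).
    apply: measurable_funM; last exact: (measurable_fun_sub Gs Gm).
    by apply: measurable_funM; [exact: measurable_indic|exact: (measurable_fun_sub Gs Gm)].
  move=> w; have /andP[a b] := q01 w; rewrite normrM -[leRHS]mul1r ler_wpM2r //.
  rewrite ger0_norm ?mulr_ge0 ?indicE // mulr_ile1 //.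
  by case: (_ \in _); rewrite ?lexx ?ler01.
rewrite ExB //; last exact: intg_indic.
rewrite (event_product ij mBi mBj cp cq p01 q01 GH).
rewrite (@cexp_mul _ _ _ P G Gs Gm (event Bi) p (fun w => \1_H w * q w)) //.
  rewrite (_ : (fun w => \1_H w * (p w * q w)) = (fun w => \1_H w * q w * p w)).
    by rewrite subrr.
  by apply/funext => w; ring.
apply: measurable_funM => //; apply: measurable_indic.
exact: sub_sigma_algebra.
Qed.

(** By the previous fact [Zi] stays centred on every event of [xi j], hence on
    the sigma-algebra for which [Zj] is measurable. *)
Lemma cond_indep_orthogonal i j (Zi : g_sigma_algebraType (joint_pi i) -> R)
    (Zj : g_sigma_algebraType (joint_pi j) -> R) : i != j ->
  measurable_fun setT Zi -> measurable_fun setT Zj ->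
  intg Zi -> intg (fun w => Zj w * Zi w) -> cexp P G Zi (fun=> 0) ->
  Ex (fun w => Zj w * Zi w) = 0.
Proof.
move=> ij mZi mZj iZi iZZ c0.
apply: (@Ex_mul_eq0 _ _ _ P (joint_pi j)) => //; first exact: joint_pi_measurable.
apply: pi_system_Ex_eq0 => //.
- exact: joint_pi_setI.
- exact: joint_pi_measurable.
- exact/joint_pi_G/sigma_setT.
move=> _ [H [Bj [GH mBj ->]]]; have mH := Gm GH.
have mXj : measurable (xi j @^-1` Bj) by exact: measurable_funPTI.
have [q cq q01] := cexp_event mBj; have [_ iq mq _] := cq.
have i1 : intg (fun w => \1_H w * (event Bj w * Zi w)).
  by apply: intg_indic => //; exact: intg_indic.
have iqZ : intg (fun w => q w * Zi w).
  apply: (intg_le _ iZi).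
    apply: measurable_funM; first exact: (measurable_fun_sub Gs Gm).
    exact: intg_measurable iZi.
  move=> w; have /andP[a b] := q01 w; rewrite normrM -[leRHS]mul1r ler_wpM2r //.
  by rewrite ger0_norm.
have i2 : intg (fun w => \1_H w * (q w * Zi w)) by exact: intg_indic.
have mHG : measurable_fun setT (\1_H : GT -> R).
  by apply: measurable_indic; exact: sub_sigma_algebra.
have E1 : Ex (fun w => (\1_H w * Zi w) * (event Bj w - q w)) = 0.
  apply: (@Ex_mul_eq0 _ _ _ P (joint_pi i) _ (fun w => \1_H w * Zi w)).
  - exact: joint_pi_measurable.
  - apply: measurable_funM => //; apply: measurable_indic.
    by apply: sub_sigma_algebra; exact: joint_pi_G.
  - by apply: intgB => //; exact: intg_event.
  - rewrite (_ : (fun w => _) = (fun w => \1_H w * (event Bj w * Zi w) - \1_H w * (q w * Zi w))).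
      exact: intgB.
    by apply/funext => w; ring.
  - exact: joint_cexp.
have E2 : Ex (fun w => (\1_H w * q w) * Zi w) = Ex (fun w => (\1_H w * q w) * 0).
  apply: (@cexp_mul _ _ _ P G Gs Gm Zi (fun=> 0) (fun w => \1_H w * q w)) => //.
  - exact: measurable_funM.
  - rewrite (_ : (fun w => _) = (fun w => \1_H w * (q w * Zi w))) //.
    by apply/funext => w; ring.
  - rewrite (_ : (fun w => _) = (fun=> 0)); first exact: intg_cst.
    by apply/funext => w; rewrite mulr0.
have E2' : Ex (fun w => \1_H w * (q w * Zi w)) = 0.
  rewrite -[RHS](Ex_cst P 0) (_ : (fun w => _) = (fun w => (\1_H w * q w) * Zi w)).
    by rewrite E2; congr (Rintegral _ _ _); apply/funext => w; rewrite mulr0.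
  by apply/funext => w; ring.
rewrite (_ : (fun w => _) = (fun w => (\1_H w * Zi w) * (event Bj w - q w) + \1_H w * (q w * Zi w))).
  rewrite ExD ?E1 ?E2' ?addr0 //.
  rewrite (_ : (fun w => _) = (fun w => \1_H w * (event Bj w * Zi w) - \1_H w * (q w * Zi w))).
    exact: intgB.
  by apply/funext => w; ring.
by apply/funext => w; rewrite /event indicI /=; ring.
Qed.

End Orthogonality.

(** * Measurability of gradients at random points *)

Section Caratheodory.
Context {dS : measure_display} {S : measurableType dS} {R : realType} {d : nat}.
Variable x : S -> 'cV[R]_d.
Hypothesis mx : forall j, measurable_fun setT (fun w => x w j ord0).

Let key n (w : S) : 'cV[int]_d := \col_j Num.floor (n.+1%:R * x w j ord0).
Let grid n (k : 'cV[int]_d) : 'cV[R]_d := \col_j ((k j ord0)%:~R / n.+1%:R).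

Let measurable_key n k : measurable [set w | key n w = k].
Proof.
have -> : [set w | key n w = k] = \bigcap_(j in [set: 'I_d])
    ((fun w => n.+1%:R * x w j ord0) @^-1` `[(k j ord0)%:~R, (k j ord0 + 1)%:~R[).
  apply/seteqP; split => w /= => [<- j _|h].
    by rewrite mxE /= in_itv /= floor_itv.
  apply/colP => j; rewrite mxE; apply: floor_def.
  by have := h j Logic.I; rewrite /= in_itv.
apply: fin_bigcap_measurable => // j _.
rewrite -[X in measurable X]setTI; apply: measurable_funM => //.
Qed.

Let cvg_grid w : (fun n => grid n (key n w)) @ \oo --> x w.
Proof.
apply: cvg_mx => j c; rewrite ord1.
have E n : grid n (key n w) j ord0 = (Num.floor (n.+1%:R * x w j ord0))%:~R / n.+1%:R.
  by rewrite !mxE.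
under eq_fun do rewrite E.
apply: (@squeeze_cvgr _ _ _ _ (fun n => x w j ord0 - harmonic n) (fun=> x w j ord0)).
- near=> n.
  have n0 : (0 : R) < n.+1%:R by rewrite ltr0n.
  have /andP[a b] := floor_itv (n.+1%:R * x w j ord0).
  rewrite ler_pdivlMr // ler_pdivrMr // mulrBl mulVf ?gt_eqF // mulrC a andbT.
  by move: b; rewrite intrD => /ltW; rewrite lerBlDr.
- rewrite -[X in _ --> X]subr0; apply: cvgB; [exact: cvg_cst|exact: cvg_harmonic].
- exact: cvg_cst.
Unshelve. all: by end_near.
Qed.

(** Rounding the vector argument to a grid leaves countably many cases;
    continuity allows the grid to be refined. *)
Lemma measurable_caratheodory (h : 'cV[R]_d -> S -> R) :
  (forall u, measurable_fun setT (h u)) -> (forall w, continuous (h^~ w)) ->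
  measurable_fun setT (fun w => h (x w) w).
Proof.
move=> mh ch; apply: (@measurable_fun_cvg _ _ _ _ (fun n w => h (grid n (key n w)) w)).
- move=> n _ B mB; rewrite setTI.
  have -> : (fun w => h (grid n (key n w)) w) @^-1` B =
     \bigcup_m (if unpickle m is Some k
       then [set w | key n w = k] `&` (h (grid n k) @^-1` B) else set0).
    apply/seteqP; split => w /=.
      by move=> hB; exists (pickle (key n w)) => //; rewrite pickleK.
    by move=> [m _]; case: (unpickle m) => //= k [<-].
  apply: bigcupT_measurable => m; case: (unpickle m) => [k|]; last exact: measurable0.
  apply: measurableI; first exact: measurable_key.
  by rewrite -[X in measurable X]setTI; exact: mh.
- move=> w _; exact: (cvg_comp _ _ (@cvg_grid w) (ch w (x w))).
Qed.

(** Partial derivatives are limits of difference quotients, each of which is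
    continuous in the vector argument. *)
Lemma measurable_grad (h : 'cV[R]_d -> S -> R) j :
  (forall u, measurable_fun setT (h u)) ->
  (forall w u, differentiable (h^~ w) u) ->
  measurable_fun setT (fun w => grad (h^~ w) (x w) j ord0).
Proof.
move=> mh dh.
pose e : 'cV[R]_d := delta_mx j ord0.
have ch w : continuous (h^~ w) by move=> u; exact: differentiable_continuous.
pose q n (u : 'cV[R]_d) w := (harmonic n)^-1 * (h (harmonic n *: e + u) w - h u w).
apply: (@measurable_fun_cvg _ _ _ _ (fun n w => q n (x w) w)).
- move=> n; apply: measurable_caratheodory => [u|w u].
    by apply: measurable_funM => //; apply: measurable_funB.
  have cs : harmonic n *: e + v @[v --> u] --> harmonic n *: e + u.
    apply: (@cvgD _ _ _ (nbhs u) _ (fun=> harmonic n *: e) id).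
      exact: cvg_cst.
    exact: cvg_id.
  have c1 := cvg_comp _ _ cs (ch w (harmonic n *: e + u)).
  have c2 : (fun v => h (harmonic n *: e + v) w - h v w) @ u -->
      h (harmonic n *: e + u) w - h u w.
    exact: (cvgB c1 (ch w u)).
  have c3 : (fun v => (harmonic n)^-1 * (h (harmonic n *: e + v) w - h v w)) @ u -->
      (harmonic n)^-1 * (h (harmonic n *: e + u) w - h u w).
    exact: cvgMr c2.
  exact: c3.
- move=> w _; rewrite mxE -deriveE; last exact: dh.
  have : derivable (h^~ w) (x w) e by exact: diff_derivable.
  rewrite /derivable /derive => /cvg_dnbhs_at_right /cvg_at_rightP.
  by apply; split => [n|]; [rewrite invr_gt0 ltr0n | exact: cvg_harmonic].
Qed.

End Caratheodory.

(** * Square-integrable random vectors *)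

Section SquareIntegrable.
Context {dT : measure_display} {T : measurableType dT} {R : realType}.
Variable P : probability T R.

Local Notation intg f := (P.-integrable setT (EFin \o f)).
Local Notation Ex f := (Rintegral P setT f).

Lemma intgM (f g : T -> R) : measurable_fun setT f -> measurable_fun setT g ->
  intg (fun w => f w ^+ 2) -> intg (fun w => g w ^+ 2) ->
  intg (fun w => f w * g w).
Proof.
move=> mf mg i1 i2; apply: (intg_le _ (intgD i1 i2)).
  exact: measurable_funM.
move=> w; rewrite [leRHS]ger0_norm ?addr_ge0 ?sqr_ge0 // normrM.
rewrite -(real_normK (num_real (f w))) -(real_normK (num_real (g w))).
have := sqr_ge0 (`|f w| - `|g w|); have := sqr_ge0 (`|f w|); have := sqr_ge0 (`|g w|).
lra.
Qed.

Lemma Ex_ae_le (f : T -> R) c : intg f -> {ae P, forall w, f w <= c} -> Ex f <= c.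
Proof.
move=> fi fc; have mf := intg_measurable fi.
have fE : {ae P, forall w, f w = Num.min (f w) c}.
  by apply: filterS fc => w h; rewrite min_l.
have mm : measurable_fun setT (fun w => Num.min (f w) c).
  by apply: measurable_minr => //; exact: measurable_cst.
have im : intg (fun w => Num.min (f w) c).
  apply: (intg_le mm (intgD (integrable_norm fi) (intg_cst P `|c|))) => w.
  rewrite [leRHS]ger0_norm /= ?addr_ge0 //.
  by case: (leP (f w) c) => _; rewrite ?lerDl ?lerDr.
rewrite (Ex_ae_eq fi im fE) -[leRHS](Ex_cst P c).
by apply: Ex_le => //; [exact: intg_cst | move=> w; rewrite ge_min lexx orbT].
Qed.

Variable G : set (set T).
Hypotheses (Gs : sigma_algebra setT G) (Gm : G `<=` measurable).
Local Notation GT := (g_sigma_algebraType G).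

(** Measurability refers to [G] and integrability to the ambient measure: with
    the past for [G] this describes known quantities, with all measurable sets
    for [G] it also covers the noise. *)
Definition sqr n (A : T -> 'cV[R]_n) := forall j,
  measurable_fun setT ((fun w => A w j ord0) : GT -> R) /\
  intg (fun w => A w j ord0 ^+ 2).

Section Closure.
Variable n : nat.
Implicit Types A B : T -> 'cV[R]_n.

Lemma sqr_measurable A j : sqr A -> measurable_fun setT (fun w => A w j ord0).
Proof. by move=> sA; apply: (measurable_fun_sub Gs Gm); have [] := sA j. Qed.

Lemma sqr_le A : (forall j, measurable_fun setT ((fun w => A w j ord0) : GT -> R)) ->
  (exists2 f : T -> R, intg f & forall j w, A w j ord0 ^+ 2 <= f w) -> sqr A.
Proof.
move=> mA [f fi fA] j; split => //; apply: (intg_le _ fi).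
  exact/measurable_funX/(measurable_fun_sub Gs Gm).
by move=> w; rewrite ger0_norm ?sqr_ge0 // (le_trans (fA j w)) // ler_norm.
Qed.

Lemma sqr_cst (c : 'cV[R]_n) : sqr (fun=> c).
Proof. by move=> j; split; [exact: measurable_cst | exact: intg_cst]. Qed.

Lemma sqrD A B : sqr A -> sqr B -> sqr (fun w => A w + B w).
Proof.
move=> sA sB; apply: sqr_le => [j|].
  rewrite (_ : (fun w => _) = (fun w => A w j ord0 + B w j ord0)).
    by apply: measurable_funD; [have [] := sA j | have [] := sB j].
  by apply/funext => w; rewrite mxE.
exists (fun w => \sum_j (2 * A w j ord0 ^+ 2 + 2 * B w j ord0 ^+ 2)).
  by apply: intg_sum => j; apply: intgD; apply: intgZ; [have [] := sA j | have [] := sB j].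
move=> j w; rewrite mxE (bigD1 j) //= -[leLHS]addr0 lerD //.
  have := sqr_ge0 (A w j ord0 - B w j ord0); lra.
by apply: sumr_ge0 => i _; rewrite addr_ge0 // mulr_ge0 // sqr_ge0.
Qed.

Lemma sqrZ c A : sqr A -> sqr (fun w => c *: A w).
Proof.
move=> sA j; have [mA iA] := sA j; split.
  rewrite (_ : (fun w => _) = (fun w => c * A w j ord0)).
    by apply: measurable_funM => //; exact: measurable_cst.
  by apply/funext => w; rewrite mxE.
rewrite (_ : (fun w => _) = (fun w => c ^+ 2 * A w j ord0 ^+ 2)); first exact: intgZ.
by apply/funext => w; rewrite mxE exprMn.
Qed.

Lemma sqrN A : sqr A -> sqr (fun w => - A w).
Proof.
move=> sA; rewrite (_ : (fun w => _) = (fun w => (-1) *: A w)); first exact: sqrZ.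
by apply/funext => w; rewrite scaleN1r.
Qed.

Lemma sqrB A B : sqr A -> sqr B -> sqr (fun w => A w - B w).
Proof. by move=> sA sB; apply: sqrD => //; exact: sqrN. Qed.

Lemma sqr_sum (I : Type) (r : seq I) (A : I -> T -> 'cV[R]_n) :
  (forall i, sqr (A i)) -> sqr (fun w => \sum_(i <- r) A i w).
Proof.
move=> sA; elim: r => [|i r IH].
  rewrite (_ : (fun w => _) = fun=> 0); first exact: sqr_cst.
  by apply/funext => w; rewrite big_nil.
rewrite (_ : (fun w => _) = fun w => A i w + \sum_(j <- r) A j w).
  exact: sqrD.
by apply/funext => w; rewrite big_cons.
Qed.

Lemma intg_dot A B : sqr A -> (forall j, measurable_fun setT (fun w => B w j ord0)) ->
  (forall j, intg (fun w => B w j ord0 ^+ 2)) -> intg (fun w => dot (A w) (B w)).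
Proof.
move=> sA mB iB; apply: intg_sum => j; apply: intgM => //.
  exact: sqr_measurable.
by have [] := sA j.
Qed.

Lemma intg_dot_sqr A B : sqr A -> sqr B -> intg (fun w => dot (A w) (B w)).
Proof.
move=> sA sB; apply: intg_dot => // j; first exact: sqr_measurable.
by have [] := sB j.
Qed.

End Closure.

Lemma sqr_mulmx m n (M : 'M[R]_(m, n)) (A : T -> 'cV[R]_n) :
  sqr A -> sqr (fun w => M *m A w).
Proof.
move=> sA; rewrite (_ : (fun w => _) = fun w => \sum_j A w j ord0 *: col j M).
  apply: sqr_sum => j i; have [mA iA] := sA j; split.
    rewrite (_ : (fun w => _) = (fun w => A w j ord0 * M i j)).
      by apply: measurable_funM => //; exact: measurable_cst.
    by apply/funext => w; rewrite !mxE.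
  rewrite (_ : (fun w => _) = (fun w => M i j ^+ 2 * A w j ord0 ^+ 2)).
    exact: intgZ.
  by apply/funext => w; rewrite !mxE exprMn mulrC.
apply/funext => w; apply/colP => i; rewrite mxE summxE.
by apply: eq_bigr => j _; rewrite !mxE mulrC.
Qed.

Lemma intg_wnorm2 n (M : 'M[R]_n) (A : T -> 'cV[R]_n) :
  sqr A -> intg (fun w => wnorm2 M (A w)).
Proof.
move=> sA; rewrite (_ : (fun w => _) = fun w => dot (A w) (M *m A w)).
  by apply: intg_dot_sqr => //; exact: sqr_mulmx.
by apply/funext => w; rewrite wnorm2E.
Qed.

Lemma sqr_stack N d (A : 'I_N -> T -> 'cV[R]_d) :
  (forall i, sqr (A i)) -> sqr (fun w => stack (fun i => A i w)).
Proof.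
move=> sA l; case: (mxtens_indexP l) => i a.
have [mA iA] := sA i a; split.
  have -> : (fun w => stack (fun i => A i w) (mxtens_index (i, a)) ord0) =
      (fun w => A i w a ord0) by apply/funext => w; rewrite stackE.
  exact: mA.
have -> : (fun w => stack (fun i => A i w) (mxtens_index (i, a)) ord0 ^+ 2) =
    (fun w => A i w a ord0 ^+ 2) by apply/funext => w; rewrite stackE.
exact: iA.
Qed.

Lemma sqr_average N d (A : 'I_N -> T -> 'cV[R]_d) :
  (forall i, sqr (A i)) -> sqr (fun w => average (fun i => A i w)).
Proof. by move=> sA; apply: sqrZ; exact: sqr_sum. Qed.

End SquareIntegrable.

Section SqrMono.
Context {dT : measure_display} {T : measurableType dT} {R : realType}.
Variables (P : probability T R) (G G' : set (set T)).
Hypothesis GG' : <<s G >> `<=` <<s G' >>.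

Lemma sqr_mono n (A : T -> 'cV[R]_n) : sqr P G A -> sqr P G' A.
Proof.
move=> sA j; have [mA iA] := sA j; split => // _ B mB.
by apply: GG'; exact: mA.
Qed.

End SqrMono.

(** * Recursions of the consensus and tracking errors *)

Section Recursions.
Context {R : realType} {N d : nat}.
Variables (W : nat -> 'M[R]_N) (tau : nat) (lam : R).
Hypothesis N0 : (0 < N)%N.
Hypothesis hW : network_assumption W tau lam.

Local Notation W1 k := (tensmx (W k) (1%:M : 'M[R]_d)).

Lemma sum_mixing k (v : 'I_N -> 'cV[R]_d) :
  \sum_i \sum_j W k i j *: v j = \sum_j v j.
Proof.
rewrite exchange_big /=; apply: eq_bigr => j _.
by rewrite -scaler_suml (col_sum hW) scale1r.
Qed.

Lemma bPi_stack (v : 'I_N -> 'cV[R]_d) :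
  bPi N d *m stack v = stack (fun=> average v).
Proof.
rewrite tensmx1_stack; congr stack; apply/funext => i.
by rewrite /average scaler_sumr; apply: eq_bigr => j _; rewrite mxE.
Qed.

Lemma bPi_mixing k : bPi N d *m W1 k = bPi N d.
Proof.
rewrite /bPi tensmx_mul mul1mx; congr tensmx.
apply/matrixP => i j; rewrite !mxE; under eq_bigr do rewrite mxE.
by rewrite -mulr_sumr (col_sum hW) mulr1.
Qed.

Lemma mixing_bPi k : W1 k *m bPi N d = bPi N d.
Proof. by rewrite /bPi tensmx_mul mul1mx (mixing_avg hW). Qed.

Lemma bPi_idem : bPi N d *m bPi N d = bPi N d :> 'M[R]__.
Proof. by rewrite /bPi tensmx_mul mul1mx avg_mx_idem. Qed.

Lemma bWtildeE k : bWtilde d W k = W1 k - bPi N d.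
Proof. exact: tensmx1B. Qed.

Lemma bWcomplE k : bWcompl W k = 1%:M - W1 k.
Proof. by rewrite /bWcompl tensmx1B tensmx11. Qed.

Lemma centered_step k (X Gv : 'cV[R]_(N * d)) :
  (1%:M - bPi N d) *m (W1 k *m (X - Gv)) =
  bWtilde d W k *m ((1%:M - bPi N d) *m X - Gv).
Proof.
have E1 : (1%:M - bPi N d) *m W1 k = bWtilde d W k.
  by rewrite bWtildeE mulmxBl mul1mx bPi_mixing.
have E2 : bWtilde d W k *m (1%:M - bPi N d) = bWtilde d W k.
  by rewrite mulmxBr mulmx1 bWtildeE mulmxBl mixing_bPi bPi_idem subrr subr0.
by rewrite mulmxA E1 !mulmxBr mulmxA E2.
Qed.

(** Adding the gradients at the minimizer makes the tracking error mean-free,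
    so [W k] acts on it as its centered part. *)
Lemma tracking_step k (Gv SG Fs : 'cV[R]_(N * d)) :
  bPi N d *m (Gv - SG + Fs) = 0 ->
  W1 k *m Gv - SG + Fs =
  bWtilde d W k *m (Gv - SG + Fs) - bWcompl W k *m (SG - Fs).
Proof.
move=> E; rewrite bWtildeE bWcomplE 2!mulmxBl E subr0 mul1mx.
rewrite !mulmxDr !mulmxN; set a := W1 k *m SG; set b := W1 k *m Fs.
set c := W1 k *m Gv.
apply/colP => i; rewrite !mxE; ring.
Qed.

End Recursions.

(** * One step in expectation *)

Ltac intg_tac := repeat first [assumption | apply: intgB | apply: intgD | apply: intgZ].

Section OneStep.
Context {R : realType} {N d : nat}.
Context {dT : measure_display} {T : measurableType dT}.
Variables (P : probability T R) (G : set (set T)).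
Hypotheses (Gs : sigma_algebra setT G) (Gm : G `<=` measurable).
Variables (W : nat -> 'M[R]_N) (tau : nat) (lam : R).
Hypotheses (N0 : (0 < N)%N) (hW : network_assumption W tau lam).
Variables (f : 'I_N -> 'cV[R]_d -> R) (gr : 'I_N -> 'cV[R]_d -> 'cV[R]_d).
Variables (L mu alpha sigma : R) (xs : 'cV[R]_d).
Hypotheses (L0 : 0 < L) (mu0 : 0 <= mu) (halpha : 0 < alpha <= 1 / (4 * L)).
Hypothesis gr_descent : forall i u v,
  f i v <= f i u + dot (gr i u) (v - u) + L / 2 * dot (v - u) (v - u).
Hypothesis gr_convex : forall i u v,
  f i u + dot (gr i u) (v - u) + mu / 2 * dot (v - u) (v - u) <= f i v.
Hypothesis gr_lipschitz : forall i u v,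
  dot (gr i u - gr i v) (gr i u - gr i v) <= L ^+ 2 * dot (u - v) (u - v).
Hypothesis xs_min : forall u, N%:R^-1 * \sum_i f i xs <= N%:R^-1 * \sum_i f i u.

Local Notation intg f := (P.-integrable setT (EFin \o f)).
Local Notation Ex f := (Rintegral P setT f).
Local Notation GT := (g_sigma_algebraType G).
Local Notation delta := (delta_of tau lam).
Local Notation eta := (eta_of tau lam).
Local Notation Q := (Q_of tau lam).
Local Notation M := (measurable : set (set T)).

Variables x g noise : 'I_N -> T -> 'cV[R]_d.
Let s i w := gr i (x i w) + noise i w.

Hypothesis sqr_x : forall i, sqr P G (x i).
Hypothesis sqr_gr : forall i, sqr P G (fun w => gr i (x i w)).
Hypothesis sqr_y : forall i, sqr P G (fun w => g i w - s i w).
Hypothesis sqr_noise : forall i, sqr P M (noise i).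
Hypothesis noise_unbiased : forall i j (Z : GT -> R), measurable_fun setT Z ->
  intg (fun w => Z w ^+ 2) -> Ex (fun w => Z w * noise i w j ord0) = 0.
Hypothesis noise_orth : forall i j, i != j ->
  Ex (fun w => dot (noise i w) (noise j w)) = 0.
Hypothesis noise_var : forall i, Ex (fun w => dot (noise i w) (noise i w)) <= sigma ^+ 2.
Hypothesis sum_g : forall w, \sum_i g i w = \sum_i s i w.

Let Ms : sigma_algebra setT M := sigma_algebra_measurable T.
Let MM : M `<=` M. Proof. by []. Qed.

Let Ni : (N%:R : R) != 0.
Proof. by rewrite pnatr_eq0 -lt0n. Qed.

Let sqrM n (A : T -> 'cV[R]_n) : sqr P G A -> sqr P M A.
Proof. by apply: sqr_mono; apply: sub_smallest2r => //; exact: sigma_algebra_measurable. Qed.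

Let intg_noise n (A : T -> 'cV[R]_n) (B : T -> 'cV[R]_n) :
  sqr P G A -> sqr P M B -> intg (fun w => dot (A w) (B w)).
Proof. by move=> sA sB; apply: (intg_dot_sqr Ms MM) => //; exact: sqrM. Qed.

Let Ex_dot_noise i (A : T -> 'cV[R]_d) : sqr P G A ->
  Ex (fun w => dot (A w) (noise i w)) = 0.
Proof.
move=> sA; rewrite /dot Ex_sum => [|j].
  by apply: big1 => j _; have [mA iA] := sA j; exact: noise_unbiased.
have [mA iA] := sA j; have [mn inn] := sqr_noise i j.
apply: intgM => //; first exact: (sqr_measurable Gs Gm).
exact: (sqr_measurable Ms MM).
Qed.

Let xb w := average (fun i => x i w).
Let ghat w := average (fun i => gr i (x i w)).
Let nbar w := average (fun i => noise i w).
Let xnext i w k := \sum_j W k i j *: (x j w - alpha *: g j w).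

Let average_next k w : average (fun i => xnext i w k) - xs =
  (xb w - xs - alpha *: ghat w) - alpha *: nbar w.
Proof.
have -> : average (fun i => xnext i w k) = xb w - alpha *: (ghat w + nbar w).
  rewrite /average (sum_mixing hW) sumrB -scaler_sumr sum_g big_split /=.
  by rewrite scalerBr scalerA mulrC -scalerA scalerDr.
move: (xb w) (ghat w) (nbar w) => a b c.
by apply/colP => i; rewrite !mxE; ring.
Qed.

Let Ex_nbar : Ex (fun w => dot (nbar w) (nbar w)) <= sigma ^+ 2 / N%:R.
Proof.
have inn i j : intg (fun w => dot (noise i w) (noise j w)).
  exact: (intg_dot_sqr Ms MM).
have -> : (fun w => dot (nbar w) (nbar w)) = (fun w =>
    N%:R^-1 ^+ 2 * \sum_i \sum_j dot (noise i w) (noise j w)).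
  apply/funext => w; rewrite /nbar /average dotZl dotZr mulrA -expr2; congr (_ * _).
  rewrite dot_suml; apply: eq_bigr => i _.
  by rewrite dotC dot_suml; apply: eq_bigr => j _; rewrite dotC.
rewrite ExZ; last by apply: intg_sum => i; exact: intg_sum.
rewrite Ex_sum => [|i]; last exact: intg_sum.
have -> : \sum_i Ex (fun w => \sum_j dot (noise i w) (noise j w)) =
    \sum_i Ex (fun w => dot (noise i w) (noise i w)).
  apply: eq_bigr => i _; rewrite Ex_sum // (bigD1 i) //= big1 ?addr0 // => j ji.
  by rewrite noise_orth // eq_sym.
rewrite expr2 -mulrA (mulrC (sigma ^+ 2)) ler_wpM2l ?invr_ge0 ?ler0n //.
rewrite ler_pdivrMl ?ltr0n //.
apply: (@le_trans _ _ (\sum_(i < N) sigma ^+ 2)).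
  by apply: ler_sum => i _; exact: noise_var.
by rewrite sumr_const card_ord mulr_natl.
Qed.

Let xhat w := (1%:M - bPi N d) *m stack (fun i => x i w).

Let xhatE w : xhat w = stack (fun i => x i w - xb w).
Proof. by rewrite /xhat mulmxBl mul1mx bPi_stack stackB. Qed.

Let sqr_xb : sqr P G xb.
Proof. exact: (sqr_average Gs Gm). Qed.

Let sqr_xhat : sqr P G xhat.
Proof. by apply: (sqr_mulmx Gs Gm); exact: sqr_stack. Qed.

(** Optimality gap: the centred noise decouples from the past, and its average
    over [N] agents has variance at most [sigma ^+ 2 / N]. *)
Lemma mean_step k :
  Ex (fun w => dot (average (fun i => xnext i w k) - xs)
                   (average (fun i => xnext i w k) - xs)) <=
  (1 - mu * alpha) * Ex (fun w => dot (xb w - xs) (xb w - xs))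
  + 3 * alpha * L / 2 * (N%:R^-1 * Ex (fun w => dot (xhat w) (xhat w)))
  + alpha ^+ 2 * sigma ^+ 2 / N%:R.
Proof.
pose a w := xb w - xs - alpha *: ghat w.
have sc : sqr P G (fun=> xs) by exact: sqr_cst.
have sgh : sqr P G ghat by exact: (sqr_average Gs Gm).
have sxs := sqrB Gs Gm sqr_xb sc.
have sa : sqr P G a := sqrB Gs Gm sxs (sqrZ alpha sgh).
have sn : sqr P M nbar by apply: (sqr_average Ms MM).
have iaa : intg (fun w => dot (a w) (a w)) by exact: (intg_dot_sqr Gs Gm).
have inn : intg (fun w => dot (nbar w) (nbar w)) by exact: (intg_dot_sqr Ms MM).
have ian : intg (fun w => dot (a w) (nbar w)) by exact: intg_noise.
have Ean : Ex (fun w => dot (a w) (nbar w)) = 0.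
  have -> : (fun w => dot (a w) (nbar w)) =
      (fun w => N%:R^-1 * \sum_i dot (a w) (noise i w)).
    apply/funext => w; rewrite /nbar /average dotZr dotC dot_suml.
    by congr (_ * _); apply: eq_bigr => i _; rewrite dotC.
  have i1 i : intg (fun w => dot (a w) (noise i w)) by exact: intg_noise.
  rewrite ExZ; last exact: intg_sum.
  by rewrite Ex_sum // big1 ?mulr0 // => i _; exact: Ex_dot_noise.
have -> : (fun w => dot (average (fun i => xnext i w k) - xs)
    (average (fun i => xnext i w k) - xs)) = (fun w => dot (a w) (a w)
    + (- (2 * alpha) * dot (a w) (nbar w) + alpha ^+ 2 * dot (nbar w) (nbar w))).
  apply/funext => w; rewrite average_next -/(a w).
  move: (a w) (nbar w) => u v.
  by rewrite !dotE (dotC v u); ring.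
rewrite ExD //; last by apply: intgD; exact: intgZ.
rewrite ExD ?ExZ //; try exact: intgZ.
rewrite Ean mulr0 add0r.
have ixx := intg_dot_sqr Gs Gm sxs sxs.
have ihh : intg (fun w => dot (xhat w) (xhat w)) by exact: (intg_dot_sqr Gs Gm).
have step : Ex (fun w => dot (a w) (a w)) <= (1 - mu * alpha) * Ex (fun w => dot (xb w - xs) (xb w - xs))
  + 3 * alpha * L / 2 * (N%:R^-1 * Ex (fun w => dot (xhat w) (xhat w))).
  rewrite -!ExZ //; last exact: intgZ.
  rewrite -ExD; [|exact: intgZ|by do 2 apply: intgZ].
  apply: Ex_le => //; first by apply: intgD; [exact: intgZ|by do 2 apply: intgZ].
  move=> w; rewrite xhatE dot_stack.
  exact: (mean_gradient_step N0 L0 mu0 gr_descent gr_convex gr_lipschitz xs_min).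
apply: lerD => //; rewrite -mulrA ler_wpM2l ?sqr_ge0 //.
Qed.

Let X w := stack (fun i => x i w).
Let Gv w := stack (fun i => g i w).
Let SG w := stack (fun i => s i w).
Let Fs := stack (fun i => gr i xs).
Let Nz w := stack (fun i => noise i w).
Let D w := stack (fun i => gr i (x i w)) - Fs.
Let z w := (alpha / eta) *: (Gv w - SG w + Fs).
Let W1 k := tensmx (W k) (1%:M : 'M[R]_d).
Let xhat' k w := (1%:M - bPi N d) *m (W1 k *m (X w - alpha *: Gv w)).
Let z' k w := (alpha / eta) *: (W1 k *m Gv w - SG w + Fs).

Let eta0 : eta != 0.
Proof. by rewrite gt_eqF // (eta_gt0 hW). Qed.

Let SGE w : SG w = D w + Fs + Nz w.
Proof. by rewrite /D subrK /SG /Nz stackD. Qed.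

Let xhat'E k w : xhat' k w = bWtilde d W k *m (xhat w - eta *: z w - alpha *: D w)
  - alpha *: (bWtilde d W k *m Nz w).
Proof.
rewrite /xhat' (centered_step N0 hW) scalemxAr -mulmxBr; congr (_ *m _).
rewrite /z scalerA mulrC divfK // SGE -/(xhat w).
apply/colP => i; rewrite !mxE; ring.
Qed.

Let bPi_tracking w : bPi N d *m (Gv w - SG w + Fs) = 0.
Proof.
rewrite /Gv /SG /Fs stackB stackD bPi_stack.
have -> : average (fun i => g i w - s i w + gr i xs) = 0.
  rewrite /average big_split /= sumrB sum_g subrr add0r.
  exact: (gbar_minimizer N0 L0 gr_descent xs_min).
by apply/colP => l; rewrite !mxE.
Qed.

Let z'E k w : z' k w =
  (bWtilde d W k *m z w - (alpha / eta) *: (bWcompl W k *m D w))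
  - (alpha / eta) *: (bWcompl W k *m Nz w).
Proof.
rewrite /z' tracking_step ?bPi_tracking //.
have -> : SG w - Fs = D w + Nz w.
  by rewrite SGE addrAC addrK.
by rewrite (mulmxDr (bWcompl W k)) scalerBr -scalemxAr scalerDr opprD addrA.
Qed.

Let Ex_dot_Nz (A : T -> 'cV[R]_(N * d)) : sqr P G A ->
  Ex (fun w => dot (A w) (Nz w)) = 0.
Proof.
move=> sA; have sN : sqr P M Nz by exact: sqr_stack.
rewrite /dot Ex_sum => [|l].
  apply: big1 => l _; have [mA iA] := sA l.
  case: (mxtens_indexP l) mA iA => i a mA iA.
  rewrite (_ : (fun w => _) = fun w => A w (mxtens_index (i, a)) ord0 * noise i w a ord0).
    exact: noise_unbiased.
  by apply/funext => w; rewrite stackE.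
have [mA iA] := sA l; have [mn inn] := sN l.
apply: intgM => //; first exact: (sqr_measurable Gs Gm).
exact: (sqr_measurable Ms MM).
Qed.

(** The cross terms are linear in the noise, with coefficients known from the
    past. *)
Let Ex_wnorm2_noise (Rm K : 'M[R]_(N * d)) c (A : T -> 'cV[R]_(N * d)) :
  sqr P G A -> Ex (fun w => wnorm2 Rm (A w - c *: (K *m Nz w))) =
  Ex (fun w => wnorm2 Rm (A w)) + Ex (fun w => wnorm2 Rm (c *: (K *m Nz w))).
Proof.
move=> sA; have sN : sqr P M Nz by exact: sqr_stack.
pose A1 w := (Rm *m K)^T *m A w; pose A2 w := K^T *m (Rm *m A w).
have sA1 : sqr P G A1 by exact: (sqr_mulmx Gs Gm).
have sA2 : sqr P G A2 by do 2 apply: (sqr_mulmx Gs Gm).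
have E w : wnorm2 Rm (A w - c *: (K *m Nz w)) =
    wnorm2 Rm (A w) + wnorm2 Rm (c *: (K *m Nz w))
    + (- c * dot (A1 w) (Nz w) + - c * dot (A2 w) (Nz w)).
  have a1 : dot (A1 w) (Nz w) = dot (A w) (Rm *m (K *m Nz w)).
    by rewrite /A1 dot_mulmx trmxK mulmxA.
  have a2 : dot (A2 w) (Nz w) = dot (K *m Nz w) (Rm *m A w).
    by rewrite /A2 dot_mulmx trmxK dotC.
  rewrite wnorm2D wnorm2N a1 a2; congr (_ + _).
  by rewrite mulmxN -scalemxAr dotNr dotNl dotZr dotZl !mulNr.
rewrite (_ : (fun w => _) = fun w => wnorm2 Rm (A w) + wnorm2 Rm (c *: (K *m Nz w))
    + (- c * dot (A1 w) (Nz w) + - c * dot (A2 w) (Nz w))); last by apply/funext.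
have i1 : intg (fun w => wnorm2 Rm (A w)) by exact: (intg_wnorm2 Gs Gm).
have i2 : intg (fun w => wnorm2 Rm (c *: (K *m Nz w))).
  by apply: (intg_wnorm2 Ms MM); apply: sqrZ; exact: (sqr_mulmx Ms MM).
have i3 : intg (fun w => dot (A1 w) (Nz w)) by exact: intg_noise.
have i4 : intg (fun w => dot (A2 w) (Nz w)) by exact: intg_noise.
rewrite ExD; [|exact: intgD|by apply: intgD; exact: intgZ].
rewrite ExD // ExD; [|exact: intgZ|exact: intgZ].
by rewrite !ExZ // !Ex_dot_Nz // !mulr0 !addr0.
Qed.

Let Rk k := Rmx d W tau lam k.

Lemma tracking_error_step k :
  Ex (fun w => wnorm2 (Rk k.+1) (xhat' k w) + 2 * wnorm2 (Rk k.+1) (z' k w)) <=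
  Ex (fun w => wnorm2 (Rk k) (xhat w) + 2 * wnorm2 (Rk k) (z w))
  - delta / 4 * Ex (fun w => dot (xhat w) (xhat w) + 2 * dot (z w) (z w))
  + 10 * alpha ^+ 2 * Q * L ^+ 2 / delta *
    (N%:R * Ex (fun w => dot (xb w - xs) (xb w - xs)) +
     Ex (fun w => dot (xhat w) (xhat w) + 2 * dot (z w) (z w)))
  + N%:R * (alpha ^+ 2 * Q * sigma ^+ 2).
Proof.
have sz : sqr P G z.
  apply: sqrZ; apply: (sqrD Gs Gm); last exact: sqr_cst.
  have -> : (fun w => Gv w - SG w) = (fun w => stack (fun i => g i w - s i w)).
    by apply/funext => w; rewrite /Gv /SG stackB.
  exact: sqr_stack.
have sD : sqr P G D := sqrB Gs Gm (sqr_stack sqr_gr) (sqr_cst P G Fs).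
pose A w := bWtilde d W k *m (xhat w - eta *: z w - alpha *: D w).
pose B w := bWtilde d W k *m z w - (alpha / eta) *: (bWcompl W k *m D w).
have sA : sqr P G A.
  apply: (sqr_mulmx Gs Gm).
  exact: (sqrB Gs Gm (sqrB Gs Gm sqr_xhat (sqrZ eta sz)) (sqrZ alpha sD)).
have sB : sqr P G B := sqrB Gs Gm (sqr_mulmx Gs Gm (bWtilde d W k) sz)
  (sqrZ (alpha / eta) (sqr_mulmx Gs Gm (bWcompl W k) sD)).
have sN : sqr P M Nz by exact: sqr_stack.
have sWN := sqrZ alpha (sqr_mulmx Ms MM (bWtilde d W k) sN).
have sCN := sqrZ (alpha / eta) (sqr_mulmx Ms MM (bWcompl W k) sN).
have iA := intg_wnorm2 Gs Gm (Rk k.+1) sA.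
have iB := intg_wnorm2 Gs Gm (Rk k.+1) sB.
have iW := intg_wnorm2 Ms MM (Rk k.+1) sWN.
have iC := intg_wnorm2 Ms MM (Rk k.+1) sCN.
have ix := intg_wnorm2 Gs Gm (Rk k) sqr_xhat.
have iz := intg_wnorm2 Gs Gm (Rk k) sz.
have ixx := intg_dot_sqr Gs Gm sqr_xhat sqr_xhat.
have izz := intg_dot_sqr Gs Gm sz sz.
have iDD := intg_dot_sqr Gs Gm sD sD.
have iNN := intg_dot_sqr Ms MM sN sN.
have sxs := sqrB Gs Gm sqr_xb (sqr_cst P G xs).
have ixs := intg_dot_sqr Gs Gm sxs sxs.
have ix' : intg (fun w => wnorm2 (Rk k.+1) (xhat' k w)).
  rewrite (_ : (fun w => _) = fun w => wnorm2 (Rk k.+1) (A w - alpha *: (bWtilde d W k *m Nz w))).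
    exact: (intg_wnorm2 Ms MM _ (sqrB Ms MM (sqrM sA) sWN)).
  by apply/funext => w; rewrite xhat'E.
have iz' : intg (fun w => wnorm2 (Rk k.+1) (z' k w)).
  rewrite (_ : (fun w => _) = fun w => wnorm2 (Rk k.+1) (B w - (alpha / eta) *: (bWcompl W k *m Nz w))).
    exact: (intg_wnorm2 Ms MM _ (sqrB Ms MM (sqrM sB) sCN)).
  by apply/funext => w; rewrite z'E.
have Ex' : Ex (fun w => wnorm2 (Rk k.+1) (xhat' k w)) = Ex (fun w => wnorm2 (Rk k.+1) (A w))
    + Ex (fun w => wnorm2 (Rk k.+1) (alpha *: (bWtilde d W k *m Nz w))).
  rewrite -Ex_wnorm2_noise //; congr (Rintegral _ _ _).
  by apply/funext => w; rewrite xhat'E.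
have Ez' : Ex (fun w => wnorm2 (Rk k.+1) (z' k w)) = Ex (fun w => wnorm2 (Rk k.+1) (B w))
    + Ex (fun w => wnorm2 (Rk k.+1) ((alpha / eta) *: (bWcompl W k *m Nz w))).
  rewrite -Ex_wnorm2_noise //; congr (Rintegral _ _ _).
  by apply/funext => w; rewrite z'E.
have drift : Ex (fun w => wnorm2 (Rk k.+1) (A w)) + 2 * Ex (fun w => wnorm2 (Rk k.+1) (B w))
  <= Ex (fun w => wnorm2 (Rk k) (xhat w)) + 2 * Ex (fun w => wnorm2 (Rk k) (z w))
  - delta / 4 * (Ex (fun w => dot (xhat w) (xhat w)) + 2 * Ex (fun w => dot (z w) (z w)))
  + 10 * alpha ^+ 2 * Q / delta * Ex (fun w => dot (D w) (D w)).
  have : Ex (fun w => wnorm2 (Rk k.+1) (A w) + 2 * wnorm2 (Rk k.+1) (B w)) <=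
      Ex (fun w => (wnorm2 (Rk k) (xhat w) + 2 * wnorm2 (Rk k) (z w)
        - delta / 4 * (dot (xhat w) (xhat w) + 2 * dot (z w) (z w)))
        + 10 * alpha ^+ 2 * Q / delta * dot (D w) (D w)).
    apply: Ex_le; [by intg_tac..|move=> w].
    exact: (lyapunov_drift alpha N0 hW).
  rewrite ExD; try by intg_tac.
  rewrite ExZ // ExD; try by intg_tac.
  rewrite ExB; try by intg_tac.
  rewrite ExD; try by intg_tac.
  rewrite [X in _ - X + _]ExZ; try by intg_tac.
  rewrite [X in _ - _ * X + _]ExD; try by intg_tac.
  by rewrite !ExZ //.
have noise_le : Ex (fun w => wnorm2 (Rk k.+1) (alpha *: (bWtilde d W k *m Nz w)))
  + 2 * Ex (fun w => wnorm2 (Rk k.+1) ((alpha / eta) *: (bWcompl W k *m Nz w)))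
  <= alpha ^+ 2 * Q * Ex (fun w => dot (Nz w) (Nz w)).
  rewrite -!ExZ // -ExD //; last exact: intgZ.
  apply: Ex_le; [by apply: intgD => //; exact: intgZ|exact: intgZ|].
  move=> w; exact: (lyapunov_noise alpha N0 hW).
have ENz : Ex (fun w => dot (Nz w) (Nz w)) <= N%:R * sigma ^+ 2.
  have inn i : intg (fun w => dot (noise i w) (noise i w)).
    exact: (intg_dot_sqr Ms MM).
  have -> : (fun w => dot (Nz w) (Nz w)) = (fun w => \sum_i dot (noise i w) (noise i w)).
    by apply/funext => w; rewrite /Nz dot_stack.
  rewrite Ex_sum //; apply: (@le_trans _ _ (\sum_(i < N) sigma ^+ 2)).
    by apply: ler_sum => i _; exact: noise_var.
  by rewrite sumr_const card_ord mulr_natl.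
have EDD : Ex (fun w => dot (D w) (D w)) <= L ^+ 2 * (N%:R * Ex (fun w => dot (xb w - xs) (xb w - xs))
    + Ex (fun w => dot (xhat w) (xhat w))).
  rewrite -!ExZ // -ExD //; last exact: intgZ.
  rewrite -ExZ; last by apply: intgD => //; exact: intgZ.
  apply: Ex_le => //; first by apply: intgZ; apply: intgD => //; exact: intgZ.
  move=> w; rewrite /D /Fs stackB dot_stack xhatE dot_stack.
  rewrite -(sum_dot_average (fun i => x i w) xs N0) mulr_sumr.
  by apply: ler_sum => i _; exact: gr_lipschitz.
have ixz : intg (fun w => 2 * dot (z w) (z w)) by exact: intgZ.
have zz0 : 0 <= Ex (fun w => dot (z w) (z w)).
  by apply: Rintegral_ge0 => w _; exact: dot_ge0.
rewrite !ExD ?ExZ //; try exact: intgZ.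
rewrite Ex' Ez'.
have dl0 := delta_gt0 hW; have Q0 := Q_ge0 (R := R) tau lam.
have c0 : 0 <= 10 * alpha ^+ 2 * Q / delta.
  by rewrite mulr_ge0 ?invr_ge0 ?(ltW dl0) // mulr_ge0 // mulr_ge0 // sqr_ge0.
have c1 : 0 <= alpha ^+ 2 * Q by rewrite mulr_ge0 // sqr_ge0.
have := ler_wpM2l c1 ENz; have := ler_wpM2l c0 EDD.
have := mulr_ge0 c0 (mulr_ge0 (sqr_ge0 L) zz0).
rewrite [10 * _ * Q * _ / delta](_ : _ = 10 * alpha ^+ 2 * Q / delta * L ^+ 2); last first.
  by rewrite mulrAC.
move: drift noise_le; move: (10 * alpha ^+ 2 * Q / delta) => c.
do !match goal with |- context [Rintegral ?m ?A ?h] =>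
  generalize (Rintegral m A h); intro end.
clear zz0 ENz EDD Ex' Ez'; lra.
Qed.

End OneStep.

(** * The stochastic gradient tracking iteration *)

Section Coordinates.
Context {dT : measure_display} {T : measurableType dT} {R : realType}.
Variables (P : probability T R) (G : set (set T)).
Hypotheses (Gs : sigma_algebra setT G) (Gm : G `<=` measurable).
Local Notation intg f := (P.-integrable setT (EFin \o f)).

Lemma coord_sq_le n (v : 'cV[R]_n) j : v j ord0 ^+ 2 <= dot v v.
Proof.
rewrite /dot (bigD1 j) //= expr2 lerDl; apply: sumr_ge0 => i _.
by rewrite -expr2 sqr_ge0.
Qed.

Lemma sqr_lipschitz d (h : 'cV[R]_d -> 'cV[R]_d) L (A : T -> 'cV[R]_d) :
  (forall u v, dot (h u - h v) (h u - h v) <= L ^+ 2 * dot (u - v) (u - v)) ->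
  sqr P G A ->
  (forall j, measurable_fun setT
    ((fun w => h (A w) j ord0) : g_sigma_algebraType G -> R)) ->
  sqr P G (fun w => h (A w)).
Proof.
move=> hL sA mh; apply: (sqr_le Gs Gm) => //.
exists (fun w => 2 * (L ^+ 2 * dot (A w) (A w)) + 2 * dot (h 0) (h 0)).
  by apply: intgD; [do 2 apply: intgZ; exact: (intg_dot_sqr Gs Gm) | exact: intg_cst].
move=> j w; apply: le_trans (coord_sq_le _ _) _.
apply: (@le_trans _ _ (2 * dot (h (A w) - h 0) (h (A w) - h 0) + 2 * dot (h 0) (h 0))).
  by rewrite -[h (A w) in leLHS](subrK (h 0)) dotD_le2.
have := hL (A w) 0; rewrite subr0 => h1.
by rewrite lerD2r ler_pM2l.
Qed.

End Coordinates.

Section Algorithm.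
Context {R : realType} {N d : nat}.
Context {dT : measure_display} {T : measurableType dT}.
Context {dX : 'I_N -> measure_display} {Xi : forall i, measurableType (dX i)}.
Variable P : probability T R.
Variables (F : forall i, 'cV[R]_d -> Xi i -> R) (D : forall i, probability (Xi i) R).
Variable xi : nat -> forall i, {mfun T >-> Xi i}.
Variables (W : nat -> 'M[R]_N) (tau : nat) (lam : R).
Variables (L mu alpha sigma : R) (xs : 'cV[R]_d).
Variables (x0 : 'I_N -> 'cV[R]_d) (x g : nat -> 'I_N -> T -> 'cV[R]_d).
Variable Fk : nat -> set (set T).
Hypothesis N0 : (0 < N)%N.
Hypothesis hF : stochastic_objective F D.
Hypothesis hW : network_assumption W tau lam.
Hypothesis hiter : sgt_iteration F xi W alpha x g x0.
Hypothesis hnoise : noise_assumption P F D xi x g Fk sigma.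
Hypotheses (L0 : 0 < L) (hmu : 0 <= mu).
Hypothesis hsmooth : forall i, L_smooth L (objective F D i).

(* The objectives enter through their gradients only; a variable keeps
   conversion from unfolding differentials. *)
Variable gr : 'I_N -> 'cV[R]_d -> 'cV[R]_d.
Hypothesis grE : forall i u, grad (objective F D i) u = gr i u.
Hypothesis gr_lipschitz : forall i u v,
  dot (gr i u - gr i v) (gr i u - gr i v) <= L ^+ 2 * dot (u - v) (u - v).

Local Notation intg f := (P.-integrable setT (EFin \o f)).
Local Notation Ex f := (Rintegral P setT f).
Local Notation M := (measurable : set (set T)).
Local Notation FT k := (g_sigma_algebraType (Fk k)).

Let Fs k : sigma_algebra setT (Fk k) := noise_sigma_algebra hnoise k.
Let Fm k : Fk k `<=` measurable := noise_sub hnoise (k := k).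
Let Ms : sigma_algebra setT M := sigma_algebra_measurable T.
Let MM : M `<=` M. Proof. by []. Qed.

Let sg k i w := sgrad F xi x k i w.
Let noise k i w := sg k i w - gr i (x k i w).

Lemma grad_noiseE k i w : grad_noise F D xi x k i w = noise k i w.
Proof. by rewrite /grad_noise grE. Qed.

Lemma measurable_iterate k i j :
  measurable_fun setT ((fun w => x k i w j ord0) : FT k -> R).
Proof.
have [ix _ iterx _] := hiter; case: k => [|k].
  rewrite (_ : (fun w => _) = fun=> x0 i j ord0); first exact: measurable_cst.
  by apply/funext => w; rewrite ix.
have E : (fun w => x k.+1 i w j ord0) =
   (fun w => \sum_l W k i l * (x k l w j ord0 - alpha * g k l w j ord0)).
  by apply/funext => w; rewrite iterx summxE; apply: eq_bigr => l _; rewrite !mxE.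
rewrite E; apply: measurable_sum => l.
have [mx mg] := noise_iterates hnoise l (ltnSn k).
apply: measurable_funM; first exact: measurable_cst.
apply: measurable_funB; first exact/(measurable_wrtP (Fs k.+1))/mx.
apply: measurable_funM; first exact: measurable_cst.
exact/(measurable_wrtP (Fs k.+1))/mg.
Qed.

(** This is needed twice: for the past of the next iteration, where the sample
    is known, and for the past joined with the current sample of one agent. *)
Lemma measurable_sgrad (S : set (set T)) k i j :
  (forall l, measurable_fun setT
    ((fun w => x k i w l ord0) : g_sigma_algebraType S -> R)) ->
  measurable_fun setT (xi k i : g_sigma_algebraType S -> Xi i) ->
  measurable_fun setT ((fun w => sg k i w j ord0) : g_sigma_algebraType S -> R).
Proof.
move=> mx mxi; have [iF dF] := hF.
apply: (@measurable_grad _ (g_sigma_algebraType S) R d (x k i) mx (fun u w => F u (xi k i w))).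
  move=> u; apply: measurableT_comp => //.
  exact: intg_measurable (iF i u).
by move=> w u; exact: dF.
Qed.

Lemma measurable_gr k i j :
  measurable_fun setT ((fun w => gr i (x k i w) j ord0) : FT k -> R).
Proof.
have := @measurable_grad _ (FT k) R d (x k i) (@measurable_iterate k i)
  (fun u _ => objective F D i u) j.
rewrite (_ : (fun w => _) = (fun w => gr i (x k i w) j ord0)); last first.
  by apply/funext => w; rewrite -grE.
apply; first by move=> u; exact: measurable_cst.
by move=> w u; have [+ _] := hsmooth i; apply.
Qed.

Let sqr_noise k i : sqr P M (noise k i).
Proof.
have [V [iN _ _ _] _] := noise_variance hnoise k i.
apply: (sqr_le Ms MM) => [j|].
  have [iNj _ _ _] := noise_unbiased hnoise k i j.
  apply/(measurable_wrtP Ms).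
  move=> A [B mB <-]; rewrite /=.
  have := intg_measurable iNj measurableT mB.
  by congr (measurable (_ `&` _)); apply/funext => w /=; rewrite grad_noiseE.
exists (fun w => enorm (grad_noise F D xi x k i w) ^+ 2) => //.
by move=> j w; rewrite enorm_sq grad_noiseE coord_sq_le.
Qed.

Let sgE k i w : sg k i w = gr i (x k i w) + noise k i w.
Proof. by rewrite addrC subrK. Qed.

Let sqrM k n (A : T -> 'cV[R]_n) : sqr P (Fk k) A -> sqr P M A.
Proof. by apply: sqr_mono; apply: sub_smallest2r => //; exact: sigma_algebra_measurable. Qed.

Let sqr_xk k i : sqr P M (x k i) -> sqr P (Fk k) (x k i).
Proof. by move=> sx j; have [_ ix] := sx j; split => //; exact: measurable_iterate. Qed.

Let sqr_grk k i : sqr P M (x k i) -> sqr P (Fk k) (fun w => gr i (x k i w)).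
Proof.
move=> sx; apply: (sqr_lipschitz (Fs k) (@Fm k) (gr_lipschitz i)).
  exact: sqr_xk.
exact: measurable_gr.
Qed.

Let sqr_sgk k i : sqr P M (x k i) -> sqr P M (sg k i).
Proof.
move=> sx; have := sqrD Ms MM (sqrM (sqr_grk sx)) (@sqr_noise k i).
by congr (sqr _ _ _); apply/funext => w; rewrite sgE.
Qed.

(** The iterates stay square integrable, so all expectations are finite. *)
Let sqr_iterates k : (forall i, sqr P M (x k i)) /\ (forall i, sqr P M (g k i)).
Proof.
have [ix ig iterx iterg] := hiter.
elim: k => [|k [sx sgk]].
  have sx i : sqr P M (x 0%N i).
    by rewrite (_ : x 0%N i = fun=> x0 i); [exact: sqr_cst | apply/funext => w; rewrite ix].
  split => // i; rewrite (_ : g 0%N i = sg 0%N i); first exact: sqr_sgk.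
  by apply/funext => w; rewrite ig.
have sx' i : sqr P M (x k.+1 i).
  rewrite (_ : x k.+1 i = fun w => \sum_j W k i j *: (x k j w - alpha *: g k j w)).
    apply: (sqr_sum Ms MM) => j; apply: sqrZ.
    exact: (sqrB Ms MM (sx j) (sqrZ alpha (sgk j))).
  by apply/funext => w; rewrite iterx.
split => // i.
rewrite (_ : g k.+1 i = fun w => \sum_j W k i j *: g k j w + sg k.+1 i w - sg k i w).
  apply: (sqrB Ms MM _ (sqr_sgk (sx i))); apply: (sqrD Ms MM _ (sqr_sgk (sx' i))).
  by apply: (sqr_sum Ms MM) => j; exact: sqrZ.
by apply/funext => w; rewrite iterg.
Qed.

(** The tracking error depends on the samples of earlier iterations only. *)
Let sqr_yk k i : sqr P (Fk k) (fun w => g k i w - sg k i w).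
Proof.
have [ix ig iterx iterg] := hiter.
have [sx sgk] := sqr_iterates k.
move=> j; have [_ iy] := sqrB Ms MM (sgk i) (sqr_sgk (sx i)) j.
split => //; case: k {sx sgk iy} => [|k].
  rewrite (_ : (fun w => _) = fun=> 0); first exact: measurable_cst.
  by apply/funext => w; rewrite ig subrr mxE.
have E : (fun w => (g k.+1 i w - sg k.+1 i w) j ord0) =
   (fun w => \sum_l W k i l * g k l w j ord0 - sg k i w j ord0).
  apply/funext => w; rewrite iterg -/(sg k.+1 i w) -/(sg k i w).
  move: (sg k.+1 i w) (sg k i w) => a b.
  rewrite addrAC addrK !mxE summxE; congr (_ - _).
  by apply: eq_bigr => l _; rewrite mxE.
rewrite E; apply: measurable_funB.
  apply: measurable_sum => l; apply: measurable_funM; first exact: measurable_cst.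
  have [_ mg] := noise_iterates hnoise l (ltnSn k).
  exact/(measurable_wrtP (Fs k.+1))/mg.
apply: measurable_sgrad => [l|].
  have [mx _] := noise_iterates hnoise i (ltnSn k).
  exact/(measurable_wrtP (Fs k.+1))/mx.
apply/(measurable_wrtP (Fs k.+1)); apply: (noise_samples hnoise).
exact: ltnSn.
Qed.

Let cexp_noise k i j : cexp P (Fk k) (fun w => noise k i w j ord0) (fun=> 0).
Proof.
have := is_condexp_cexp (Fs k) (@Fm k) (noise_unbiased hnoise k i j).
by congr (cexp _ _ _ _); apply/funext => w; rewrite grad_noiseE.
Qed.

Let noise_unb k i j (Z : FT k -> R) : measurable_fun setT Z ->
  intg (fun w => Z w ^+ 2) -> Ex (fun w => Z w * noise k i w j ord0) = 0.
Proof.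
move=> mZ iZ; have [mn inn] := @sqr_noise k i j.
rewrite (cexp_mul (Fs k) (@Fm k) (cexp_noise k i j) mZ).
- rewrite (_ : (fun w => _) = fun=> 0) ?Ex_cst //.
  by apply/funext => w; rewrite mulr0.
- apply: intgM => //; first exact: (measurable_fun_sub (Fs k) (@Fm k)).
  exact: (sqr_measurable Ms MM j (@sqr_noise k i)).
- rewrite (_ : (fun w => _) = fun=> 0); first exact: intg_cst.
  by apply/funext => w; rewrite mulr0.
Qed.

Let noise_joint k i j : measurable_fun setT
  ((fun w => noise k i w j ord0) : g_sigma_algebraType (joint_pi (Fk k) (xi k) i) -> R).
Proof.
rewrite (_ : (fun w => _) = fun w => sg k i w j ord0 - gr i (x k i w) j ord0); last first.
  apply/funext => w; rewrite /noise; move: (sg k i w) (gr i (x k i w)) => a b.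
  by rewrite !mxE.
apply: measurable_funB.
  apply: measurable_sgrad => [l|]; last exact: joint_measurable_xi.
  apply: joint_measurable_G; apply/(measurable_wrtP (Fs k)).
  exact: measurable_iterate.
apply: joint_measurable_G; apply/(measurable_wrtP (Fs k)).
exact: measurable_gr.
Qed.

Let noise_orthogonal k i i' : i != i' ->
  Ex (fun w => dot (noise k i w) (noise k i' w)) = 0.
Proof.
move=> ii'.
have mn l j := sqr_measurable Ms MM j (@sqr_noise k l).
have inn j : intg (fun w => noise k i w j ord0 * noise k i' w j ord0).
  by apply: intgM => //; [have [] := @sqr_noise k i j | have [] := @sqr_noise k i' j].
rewrite /dot Ex_sum // big1 // => j _.
have [in' _ _ _] := cexp_noise k i' j.
apply: (cond_indep_orthogonal (Fs k) (@Fm k) (noise_indep hnoise k)) => //.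
by rewrite eq_sym.
Qed.

Let noise_second_moment k i :
  Ex (fun w => dot (noise k i w) (noise k i w)) <= sigma ^+ 2.
Proof.
have [V cV Vs] := noise_variance hnoise k i.
have [_ iV _ /(_ _ (sigma_setT (Fs k)))] := is_condexp_cexp (Fs k) (@Fm k) cV.
rewrite (_ : (fun w => _ * V w) = V); last by apply/funext => w; rewrite indicT mul1r.
rewrite (_ : (fun w => _ * _) = fun w => dot (noise k i w) (noise k i w)); last first.
  by apply/funext => w; rewrite indicT mul1r enorm_sq grad_noiseE.
by move=> <-; exact: Ex_ae_le.
Qed.

(** Mixing preserves the sum of the trackers, and each update replaces the old
    sampled gradients by the new ones. *)
Let sum_tracker k w : \sum_i g k i w = \sum_i (gr i (x k i w) + noise k i w).
Proof.
have [ix ig iterx iterg] := hiter.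
under [RHS]eq_bigr do rewrite -sgE.
have step k' (a b : 'I_N -> 'cV[R]_d) : \sum_i g k' i w = \sum_i b i ->
    \sum_i (\sum_j W k' i j *: g k' j w + a i - b i) = \sum_i a i.
  by move=> E; rewrite !big_split /= (sum_mixing hW) E sumrN addrAC subrr add0r.
elim: k => [|k IH]; first by apply: eq_bigr => i _; rewrite ig.
rewrite -(step k (fun i => sg k.+1 i w) (fun i => sg k i w) IH).
by apply: eq_bigr => i _; rewrite iterg.
Qed.

Let z k w := (alpha / eta_of tau lam) *:
  (stack (fun i => g k i w) - stack (fun i => gr i (x k i w) + noise k i w)
   + stack (fun i => gr i xs)).
Let xh k w := (1%:M - bPi N d) *m stack (fun i => x k i w).

Let zvecE k w : zvec F D xi tau lam alpha xs x g k w = z k w.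
Proof.
rewrite /zvec /ytilde /yvec /z; congr (_ *: (_ - stack _ + stack _)).
  by apply/funext => i; rewrite -sgE.
by apply/funext => i; rewrite grE.
Qed.

Let sqr_z k : sqr P (Fk k) (z k).
Proof.
have [sx _] := sqr_iterates k.
apply: sqrZ; apply: (sqrD (Fs k) (@Fm k)); last exact: sqr_cst.
rewrite (_ : (fun w => _) = fun w => stack (fun i => g k i w - sg k i w)).
  exact: (sqr_stack (@sqr_yk k)).
by apply/funext => w; rewrite -stackB; congr (_ - stack _); apply/funext => i; rewrite sgE.
Qed.

Let sqr_xh k : sqr P (Fk k) (xh k).
Proof.
have [sx _] := sqr_iterates k; apply: (sqr_mulmx (Fs k) (@Fm k)).
by apply: sqr_stack => i; exact: sqr_xk.
Qed.

Let sqr_gap k : sqr P (Fk k) (fun w => average (fun i => x k i w) - xs).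
Proof.
have [sx _] := sqr_iterates k.
apply: (sqrB (Fs k) (@Fm k) _ (sqr_cst P (Fk k) xs)).
by apply: (sqr_average (Fs k) (@Fm k)) => i; exact: sqr_xk.
Qed.

Let Xr k := Ex (fun w => dot (average (fun i => x k i w) - xs) (average (fun i => x k i w) - xs)).
Let Er k := Ex (fun w => wnorm2 (Rmx d W tau lam k) (xh k w) + 2 * wnorm2 (Rmx d W tau lam k) (z k w)).
Let Etr k := Ex (fun w => dot (xh k w) (xh k w) + 2 * dot (z k w) (z k w)).

Lemma XtildeE k : Xtilde P xs x k = (Xr k)%:E.
Proof.
rewrite /Xtilde unlock -ExE; last exact: (intg_dot_sqr (Fs k) (@Fm k)).
by apply: eq_integral => w _; rewrite enorm_sq.
Qed.

Lemma ElyapE k : Elyap P F D xi W tau lam alpha xs x g k = (N%:R^-1 * Er k)%:E.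
Proof.
rewrite /Elyap unlock EFinM -ExE.
  by congr (_ * _)%E; apply: eq_integral => w _; rewrite zvecE.
apply: intgD; first exact: (intg_wnorm2 (Fs k) (@Fm k)).
by apply: intgZ; exact: (intg_wnorm2 (Fs k) (@Fm k)).
Qed.

Lemma EtildeE k : Etilde P F D xi tau lam alpha xs x g k = (N%:R^-1 * Etr k)%:E.
Proof.
rewrite /Etilde unlock EFinM -ExE.
  by congr (_ * _)%E; apply: eq_integral => w _; rewrite zvecE !enorm_sq.
apply: intgD; first exact: (intg_dot_sqr (Fs k) (@Fm k)).
by apply: intgZ; exact: (intg_dot_sqr (Fs k) (@Fm k)).
Qed.

Hypothesis halpha : 0 < alpha <= 1 / (4 * L).
Hypothesis gr_descent : forall i u v, objective F D i v <=
  objective F D i u + dot (gr i u) (v - u) + L / 2 * dot (v - u) (v - u).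
Hypothesis gr_convex : forall i u v, objective F D i u + dot (gr i u) (v - u)
  + mu / 2 * dot (v - u) (v - u) <= objective F D i v.
Hypothesis hmin : forall u, global_objective F D xs <= global_objective F D u.

Local Notation delta := (delta_of tau lam).
Local Notation Q := (Q_of tau lam).

Lemma gap_recursion k : Xr k.+1 <= (1 - mu * alpha) * Xr k
  + 3 * alpha * L / 2 * (N%:R^-1 * Etr k) + alpha ^+ 2 * sigma ^+ 2 / N%:R.
Proof.
have [sx _] := sqr_iterates k; have [ix ig iterx iterg] := hiter.
have := @mean_step R N d dT T P (Fk k) (Fs k) (@Fm k) W tau lam N0 hW
  (objective F D) gr L mu alpha sigma xs L0 hmu halpha gr_descent gr_convex
  gr_lipschitz hmin (x k) (g k) (noise k) (fun i => sqr_xk (sx i))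
  (fun i => sqr_grk (sx i)) (@sqr_noise k) (@noise_unb k) (@noise_orthogonal k)
  (@noise_second_moment k) (sum_tracker k) k.
rewrite -/(Xr k).
have -> : (fun w => dot (average (fun i => \sum_j W k i j *: (x k j w - alpha *: g k j w)) - xs)
   (average (fun i => \sum_j W k i j *: (x k j w - alpha *: g k j w)) - xs))
  = (fun w => dot (average (fun i => x k.+1 i w) - xs) (average (fun i => x k.+1 i w) - xs)).
  apply/funext => w.
  have -> // : (fun i => x k.+1 i w) =
    (fun i => \sum_j W k i j *: (x k j w - alpha *: g k j w)).
  by apply/funext => i; rewrite iterx.
move=> h; apply: (le_trans h); rewrite lerD2r lerD2l.
have /andP[a0 _] := halpha.
rewrite ler_wpM2l ?ler_wpM2l ?invr_ge0 ?ler0n //.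
  by rewrite !mulr_ge0 // ltW.
have ixx := intg_dot_sqr (Fs k) (@Fm k) (@sqr_xh k) (@sqr_xh k).
have izz := intg_dot_sqr (Fs k) (@Fm k) (@sqr_z k) (@sqr_z k).
apply: Ex_le => //; first by apply: intgD => //; exact: intgZ.
by move=> w; rewrite lerDl mulr_ge0 // dot_ge0.
Qed.

Lemma lyapunov_recursion k : Er k.+1 <= Er k - delta / 4 * Etr k
  + 10 * alpha ^+ 2 * Q * L ^+ 2 / delta * (N%:R * Xr k + Etr k)
  + N%:R * (alpha ^+ 2 * Q * sigma ^+ 2).
Proof.
have [sx _] := sqr_iterates k; have [ix ig iterx iterg] := hiter.
have sy i : sqr P (Fk k) (fun w => g k i w - (gr i (x k i w) + noise k i w)).
  rewrite (_ : (fun w => _) = fun w => g k i w - sg k i w); first exact: sqr_yk.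
  by apply/funext => w; rewrite sgE.
have := @tracking_error_step R N d dT T P (Fk k) (Fs k) (@Fm k) W tau lam N0 hW
  (objective F D) gr L alpha sigma xs L0 gr_descent
  gr_lipschitz hmin (x k) (g k) (noise k) (fun i => sqr_xk (sx i))
  (fun i => sqr_grk (sx i)) sy (@sqr_noise k) (@noise_unb k)
  (@noise_second_moment k) (sum_tracker k) k.
apply: le_trans; rewrite /Er le_eqVlt; apply/orP; left; apply/eqP.
congr (Rintegral _ _ _); apply/funext => w /=.
have -> : xh k.+1 w = (1%:M - bPi N d) *m (tensmx (W k) (1%:M : 'M[R]_d) *m
    (stack (fun i => x k i w) - alpha *: stack (fun i => g k i w))).
  rewrite /xh stackZ stackB tensmx1_stack; congr (_ *m stack _).
  by apply/funext => i; rewrite iterx.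
have -> // : z k.+1 w = (alpha / eta_of tau lam) *:
    (tensmx (W k) (1%:M : 'M[R]_d) *m stack (fun i => g k i w)
     - stack (fun i => gr i (x k i w) + noise k i w) + stack (fun i => gr i xs)).
have E i : g k.+1 i w - (gr i (x k.+1 i w) + noise k.+1 i w) =
    \sum_j W k i j *: g k j w - (gr i (x k i w) + noise k i w).
  rewrite -!sgE iterg -/(sg k.+1 i w) -/(sg k i w).
  move: (sg k.+1 i w) (sg k i w) => a b.
  by apply/colP => j; rewrite !mxE; ring.
have {}E : (fun i => g k.+1 i w - (gr i (x k.+1 i w) + noise k.+1 i w)) =
  (fun i => \sum_j W k i j *: g k j w - (gr i (x k i w) + noise k i w)) by apply/funext.
by rewrite tensmx1_stack [in RHS]stackB -E -stackB.
Qed.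

End Algorithm.

Theorem lemma3 (R : realType) (N d : nat) (hN : (1 <= N)%N) (hd : (1 <= d)%N)
  (dT : measure_display) (T : measurableType dT) (P : probability T R)
  (dX : 'I_N -> measure_display) (Xi : forall i, measurableType (dX i))
  (F : forall i, 'cV[R]_d -> Xi i -> R)
  (D : forall i, probability (Xi i) R)
  (xi : nat -> forall i, {mfun T >-> Xi i})
  (W : nat -> 'M[R]_N) (tau : nat) (lam : R)
  (L mu alpha sigma : R) (xs : 'cV[R]_d)
  (x0 : 'I_N -> 'cV[R]_d) (x g : nat -> 'I_N -> T -> 'cV[R]_d)
  (Fk : nat -> set (set T))
  (hF : stochastic_objective F D)
  (hL : 0 < L) (hmu : 0 <= mu <= L)
  (hsmooth : forall i, L_smooth L (objective F D i))
  (hconvex : forall i, strongly_convex mu (objective F D i))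
  (hmin : forall u, global_objective F D xs <= global_objective F D u)
  (hW : network_assumption W tau lam)
  (hiter : sgt_iteration F xi W alpha x g x0)
  (hnoise : noise_assumption P F D xi x g Fk sigma)
  (halpha : 0 < alpha <= 1 / (4 * L)) :
  let delta := delta_of tau lam in
  let Q := Q_of tau lam in
  let X := Xtilde P xs x in
  let E := Elyap P F D xi W tau lam alpha xs x g in
  let Et := Etilde P F D xi tau lam alpha xs x g in
  forall k : nat,
    (X k.+1 <= (1 - mu * alpha)%:E * X k + (3 * alpha * L / 2)%:E * Et k
               + (alpha ^+ 2 * sigma ^+ 2 / N%:R)%:E)%E /\
    (E k.+1 <= E k - (delta / 4)%:E * Et k
               + (10 * alpha ^+ 2 * Q * L ^+ 2 / delta)%:E * (X k + Et k)
               + (alpha ^+ 2 * Q * sigma ^+ 2)%:E)%E.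
Proof.
move=> delta Q X E Et k.
have /andP[mu0 _] := hmu.
pose gr i := grad (objective F D i).
have grE i u : grad (objective F D i) u = gr i u by [].
have gr_lipschitz i u v : dot (gr i u - gr i v) (gr i u - gr i v) <=
    L ^+ 2 * dot (u - v) (u - v) by apply: L_smooth_sq => //; exact: ltW.
have gr_descent i u v : objective F D i v <= objective F D i u
    + dot (gr i u) (v - u) + L / 2 * dot (v - u) (v - u).
  exact: descent_lemma.
have gr_convex i u v : objective F D i u + dot (gr i u) (v - u)
    + mu / 2 * dot (v - u) (v - u) <= objective F D i v.
  by apply: strongly_convex_grad => //; have [df _] := hsmooth i; exact: df.
clearbody gr.
have XE := XtildeE xs hiter hnoise hsmooth grE gr_lipschitz.
have EE := ElyapE tau lam xs hF hiter hnoise hsmooth grE gr_lipschitz.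
have EtE := EtildeE tau lam xs hF hiter hnoise hsmooth grE gr_lipschitz.
have gap := gap_recursion hN hF hW hiter hnoise hL mu0 hsmooth grE gr_lipschitz
  halpha gr_descent gr_convex hmin k.
have lyap := lyapunov_recursion hN hF hW hiter hnoise hL hsmooth grE gr_lipschitz
  gr_descent hmin k.
rewrite /X /E /Et !XE !EE !EtE; split.
  by rewrite -!EFinM -!EFinD lee_fin.
rewrite -!EFinM -EFinB -!EFinD lee_fin.
have N0 : (0 : R) < N%:R by rewrite ltr0n.
rewrite ler_pdivrMl //; apply: (le_trans lyap).
set e := Rintegral _ _ _; set et := Rintegral _ _ _; set xx := Rintegral _ _ _.
have dl0 : delta != 0 by rewrite gt_eqF // (delta_gt0 hW).
rewrite -/delta -/Q le_eqVlt; apply/orP; left; apply/eqP; field.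
by rewrite dl0 gt_eqF.
Qed.
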